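(* Let $E$ be a complete local ring with residue field $k$ of characteristic $p>0$, let $F$ be a (one-dimensional commutative) formal group law over $E$, and let $R=E[[\hat q]]$. Then $R$ pro-represents the functor $\underline{\mathrm{Ext}}[\mathbb{Q}_p/\mathbb{Z}_p,F]$ on test rings, with $\mathrm{Tate}(F)$ as universal example. That is, for every test ring $T$, sending a continuous $E$-algebra homomorphism $R\to T$ to the class of the extension $$F_T\to \mathrm{Tate}(F)_T\times_{(\mathbb{Q}/\mathbb{Z})_T}(\mathbb{Q}_p/\mathbb{Z}_p)_T\to(\mathbb{Q}_p/\mathbb{Z}_p)_T$$ (the base change of $\mathrm{Tate}(F)$ to $T$, restricted along $\mathbb{Q}_p/\mathbb{Z}_p=\mathbb{Z}[\tfrac1p]/\mathbb{Z}\subset\mathbb{Q}/\mathbb{Z}$) is a bijection from the set of such homomorphisms to $\underline{\mathrm{Ext}}[\mathbb{Q}_p/\mathbb{Z}_p,F](T)$, natural in $T$.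
   Context: Test rings: Artin local $E$-algebras with residue field $k$. A formal scheme is a filtered colimit of affine schemes; a formal group scheme is an abelian group object in formal schemes. $F$ is also regarded as the associated formal group over $E$, and a subscript $T$ denotes base change to $T$. For an abelian group $A$, $A_T=\operatorname{spec}T^A$ is the constant formal group scheme over $T$. For a formal group scheme $G$ over $T$, $\mathrm{Ext}[A,G]$ is the set of isomorphism classes of extensions $G\to X\to A_T$ of formal group schemes over $T$. For a formal group scheme $G$ over $E$, $\underline{\mathrm{Ext}}[A,G]$ is the functor on test rings $T\mapsto\mathrm{Ext}[A_T,G_T]$. $\mathrm{Tate}(F)$ is the formal group scheme over $R$ which is the disjoint union $\bigcup_{a\in\mathbb{Q}\cap[0,1)}F_R\times\{a\}$ with group law on points $$(g,a)\cdot(h,b)=\begin{cases}(g+_F h,\ a+b)& a+b<1,\\ (g+_F h-_F\hat q,\ a+b-1)& a+b\ge 1.\end{cases}$$ Equivalently, it is the pushout of the extension $\mathbb{Z}\to\mathbb{Q}\to\mathbb{Q}/\mathbb{Z}$ along the homomorphism $\mathbb{Z}\to F_R$, $m\mapsto[m]_F(\hat q)$, so there is an extension $F_R\to\mathrm{Tate}(F)\to\mathbb{Q}/\mathbb{Z}$. *)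

(* Defs.v *)
From HB Require Import structures.
From mathcomp Require Import all_boot all_order all_algebra.
From mathcomp Require Import finmap.
From mathcomp Require Import boolp classical_sets functions cardinality fsbigop.

Set Implicit Arguments.
Unset Strict Implicit.
Unset Printing Implicit Defensive.

Import Order.TTheory GRing.Theory Num.Theory.
Local Open Scope classical_set_scope.
Local Open Scope ring_scope.

Record fps (A : Type) := FPS { fcoef : nat -> A }.

Lemma fcoef_inj (A : Type) : injective (@fcoef A).
Proof. by move=> [f] [g] /= ->. Qed.

Lemma fpsP (A : Type) (f g : fps A) : fcoef f =1 fcoef g -> f = g.
Proof. by move=> /funext /fcoef_inj. Qed.

HB.instance Definition _ (A : Type) := gen_eqMixin (fps A).
HB.instance Definition _ (A : Type) := gen_choiceMixin (fps A).

Section FpsRing.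
Variable A : comNzRingType.
Implicit Types f g h : fps A.

Definition fps_zero : fps A := FPS (fun=> 0).
Definition fps_add f g := FPS (fun n => fcoef f n + fcoef g n).
Definition fps_opp f := FPS (fun n => - fcoef f n).
Definition fpsC (a : A) : fps A := FPS (fun n => if n is 0%N then a else 0).
Definition fpsX : fps A := FPS (fun n => (n == 1%N)%:R).
Definition fps_mul f g :=
  FPS (fun n => \sum_(i < n.+1) fcoef f i * fcoef g (n - i)).

Fact fps_addA : associative fps_add.
Proof. by move=> f g h; apply: fpsP => n /=; rewrite addrA. Qed.
Fact fps_addC : commutative fps_add.
Proof. by move=> f g; apply: fpsP => n /=; rewrite addrC. Qed.
Fact fps_add0 : left_id fps_zero fps_add.
Proof. by move=> f; apply: fpsP => n /=; rewrite add0r. Qed.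
Fact fps_addN : left_inverse fps_zero fps_opp fps_add.
Proof. by move=> f; apply: fpsP => n /=; rewrite addNr. Qed.

HB.instance Definition _ :=
  GRing.isZmodule.Build (fps A) fps_addA fps_addC fps_add0 fps_addN.

Let tp (m : nat) f : {poly A} := \poly_(i < m) fcoef f i.

Let fps_mulE m n f g : (n < m)%N -> fcoef (fps_mul f g) n = (tp m f * tp m g)`_n.
Proof.
move=> nm; rewrite coefM; apply: eq_bigr => -[i /= lei] _.
by rewrite !coef_poly (leq_ltn_trans _ nm) // (leq_ltn_trans (leq_subr _ _) nm).
Qed.

Fact fps_mulC : commutative fps_mul.
Proof. by move=> f g; apply: fpsP => n; rewrite !(@fps_mulE n.+1) // mulrC. Qed.

Fact fps_mulA : associative fps_mul.
Proof.
move=> f g h; apply: fpsP => n.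
transitivity (tp n.+1 f * tp n.+1 g * tp n.+1 h)`_n.
  rewrite -mulrA coefM; apply: eq_bigr => -[i /= lei] _.
  rewrite coef_poly lei; congr (_ * _).
  by rewrite -(@fps_mulE n.+1) // ltnS leq_subr.
rewrite coefM; apply: eq_bigr => -[i /= lei] _.
by rewrite [X in _ * X]coef_poly ltnS leq_subr -(@fps_mulE n.+1).
Qed.

Fact fps_mul1 : left_id (fpsC 1) fps_mul.
Proof.
move=> f; apply: fpsP => n /=; rewrite big_ord_recl /= mul1r subn0.
by rewrite big1 ?addr0 // => i _; rewrite mul0r.
Qed.

Fact fps_mulDl : left_distributive fps_mul fps_add.
Proof.
move=> f g h; apply: fpsP => n /=; rewrite -big_split /=.
by apply: eq_bigr => i _; rewrite mulrDl.
Qed.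

Fact fps_1neq0 : fpsC 1 != fps_zero.
Proof. by apply/eqP => /(congr1 (fun f => fcoef f 0)) /= /eqP; rewrite oner_eq0. Qed.

HB.instance Definition _ := GRing.Zmodule_isComNzRing.Build (fps A)
  fps_mulA fps_mulC fps_mul1 fps_mulDl fps_1neq0.

Fact fpsC_is_zmod_morphism : zmod_morphism fpsC.
Proof. by move=> a b; apply: fpsP => -[|n] //=; rewrite subr0. Qed.
Fact fpsC_is_monoid_morphism : monoid_morphism fpsC.
Proof.
split=> // a b; apply: fpsP => -[|n] /=; first by rewrite big_ord1.
rewrite big_ord_recl /= mulr0 add0r big1 // => i _.
by rewrite mul0r.
Qed.
HB.instance Definition _ :=
  GRing.isZmodMorphism.Build A (fps A) fpsC fpsC_is_zmod_morphism.
HB.instance Definition _ :=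
  GRing.isMonoidMorphism.Build A (fps A) fpsC fpsC_is_monoid_morphism.

End FpsRing.

Section FpsUnit.
Variable A : comUnitRingType.
Implicit Types f g : fps A.

Definition fps_unit : {pred fps A} := fun f => fcoef f 0 \is a GRing.unit.

(* The first n coefficients of the inverse of f. *)
Fixpoint fps_inv_prefix f (n : nat) : seq A :=
  if n is m.+1 then
    let s := fps_inv_prefix f m in
    rcons s ((fcoef f 0)^-1 *
             ((m == 0%N)%:R - \sum_(i < m) fcoef f (m - i) * s`_i))
  else [::].

Definition fps_inv f : fps A :=
  if f \in fps_unit then FPS (fun n => (fps_inv_prefix f n.+1)`_n) else f.

Let size_prefix f n : size (fps_inv_prefix f n) = n.
Proof. by elim: n => //= n IH; rewrite size_rcons IH. Qed.

Let nth_prefix f n i : (i < n)%N ->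
  (fps_inv_prefix f n)`_i = (fps_inv_prefix f i.+1)`_i.
Proof.
elim: n => // n IH; rewrite ltnS leq_eqVlt => /orP[/eqP-> //|lt_in].
by rewrite /= nth_rcons size_prefix lt_in IH.
Qed.

Let coef_inv f n : f \in fps_unit ->
  fcoef (fps_inv f) n = (fcoef f 0)^-1 *
    ((n == 0%N)%:R - \sum_(i < n) fcoef f (n - i) * fcoef (fps_inv f) i).
Proof.
move=> uf; rewrite /fps_inv uf /= nth_rcons size_prefix ltnn eqxx.
by congr (_ * (_ - _)); apply: eq_bigr => -[i /= lt_in] _; rewrite nth_prefix.
Qed.

Fact fps_mulVr : {in fps_unit, left_inverse 1 fps_inv *%R}.
Proof.
move=> f uf; rewrite mulrC; apply: fpsP => n.
change (\sum_(i < n.+1) fcoef f i * fcoef (fps_inv f) (n - i)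
  = fcoef (fpsC 1) n).
rewrite (reindex_inj rev_ord_inj) /= big_ord_recr /= subnn subn0.
rewrite [fcoef (fps_inv f) n]coef_inv // mulrA divrr // mul1r addrC.
under eq_bigr => i _ do rewrite subSS subKn ?(ltnW (ltn_ord i)) //.
by rewrite subrK; case: n.
Qed.

Fact fps_unitPl f g : g * f = 1 -> fps_unit f.
Proof.
move=> /(congr1 (fun h => fcoef h 0)).
change (\sum_(i < 1) fcoef g i * fcoef f (0 - i) = 1 -> fps_unit f).
by rewrite big_ord1 => gf; apply/unitrP; exists (fcoef g 0); split; rewrite // mulrC.
Qed.

Fact fps_inv_out : {in [predC fps_unit], fps_inv =1 id}.
Proof. by move=> f; rewrite inE /fps_inv => /negPf ->. Qed.

HB.instance Definition _ := GRing.ComNzRing_hasMulInverse.Build (fps A)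
  fps_mulVr fps_unitPl fps_inv_out.

End FpsUnit.
Section Adic.
Variable A : comUnitRingType.

(* A is local and r induces an isomorphism from its residue field to k. *)
Definition residue_map (k : fieldType) (r : {rmorphism A -> k}) : Prop :=
  (forall y, exists x, r x = y) /\ (forall x, (x \is a GRing.unit) = (r x != 0)).

Definition is_ideal (I : set A) : Prop :=
  [/\ I 0, forall x y, I x -> I y -> I (x + y) & forall a x, I x -> I (a * x)].

Definition artinian : Prop :=
  forall I : nat -> set A, (forall n, is_ideal (I n)) ->
    (forall n, I n.+1 `<=` I n) -> exists N, forall n, (N <= n)%N -> I n = I N.

Definition ideal_prod (I J : set A) : set A :=
  [set x | exists n (a b : 'I_n -> A),
     [/\ forall i, I (a i), forall i, J (b i) & x = \sum_i a i * b i]].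

(* For a local ring the nonunits form the maximal ideal m, and
   [maxpow n] is m^n. *)
Fixpoint maxpow (n : nat) : set A :=
  if n is n'.+1 then ideal_prod [set x | x \isn't a GRing.unit] (maxpow n')
  else setT.

(* A -> lim_n A/m^n is injective and surjective. *)
Definition adic_complete : Prop :=
  (forall x, (forall n, maxpow n x) -> x = 0) /\
  (forall u : nat -> A, (forall n, maxpow n (u n.+1 - u n)) ->
     exists x, forall n, maxpow n (x - u n)).

End Adic.
Arguments maxpow : clear implicits.

Definition adic_continuous (A B : comUnitRingType) (f : A -> B) : Prop :=
  forall m, exists n, forall x, maxpow A n x -> maxpow B m (f x).

Lemma maxpow_exp (A : comUnitRingType) (x : A) n :
  x \isn't a GRing.unit -> maxpow A n (x ^+ n).
Proof.
move=> nx; elim: n => // n IH /=.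
by exists 1%N, (fun=> x), (fun=> x ^+ n); split; rewrite ?big_ord1 ?exprS.
Qed.

Lemma local_continuous (A B : comUnitRingType) (f : {rmorphism A -> B}) :
  (forall x, f x \is a GRing.unit -> x \is a GRing.unit) -> adic_continuous f.
Proof.
move=> floc m; exists m; elim: m => // m IH _ [n [a [b [Ia Jb ->]]]].
exists n, (f \o a), (f \o b); split=> [i|i|].
- by apply: contra (Ia i) => /=; exact: floc.
- exact/IH/Jb.
- by rewrite rmorph_sum; apply: eq_bigr => i _; rewrite rmorphM.
Qed.

Record cmor (A B : comUnitRingType) := CMor {
  cm_fun :> {rmorphism A -> B};
  cm_cont : adic_continuous cm_fun
}.

Lemma comp_continuous (A B C : comUnitRingType) (g : cmor B C) (f : cmor A B) :
  adic_continuous (g \o f).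
Proof.
move=> m; have [n gn] := cm_cont g m; have [l fl] := cm_cont f n.
by exists l => x /fl /gn.
Qed.

Definition cmor_comp (A B C : comUnitRingType) (g : cmor B C) (f : cmor A B) :
  cmor A C := CMor (comp_continuous g f).

(* The affine schemes over Spf A: A-algebras (possibly zero) for which the
   structure map is continuous to the discrete topology.  When the maximal
   ideal of A is nilpotent, these are all A-algebras. *)
Record dalg (A : comUnitRingType) := DAlg {
  da_ring :> comPzRingType;
  da_str : {rmorphism A -> da_ring};
  da_disc : exists n, forall x, maxpow A n x -> da_str x = 0
}.

Record dhom (A : comUnitRingType) (S S' : dalg A) := DHom {
  dh_fun :> {rmorphism S -> S'};
  dh_str : forall a, dh_fun (da_str S a) = da_str S' a
}.

Lemma res_disc (A B : comUnitRingType) (f : cmor A B) (S : dalg B) :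
  exists n, forall x, maxpow A n x -> (da_str S \o f) x = 0.
Proof.
have [m Sm] := da_disc S; have [n fn] := cm_cont f m.
by exists n => x /fn /Sm.
Qed.

Definition res (A B : comUnitRingType) (f : cmor A B) (S : dalg B) : dalg A :=
  DAlg (res_disc f S).

Lemma res_hom_str (A B : comUnitRingType) (f : cmor A B) (S S' : dalg B)
  (h : dhom S S') a : h (da_str (res f S) a) = da_str (res f S') a.
Proof. exact: dh_str. Qed.

Definition res_hom (A B : comUnitRingType) (f : cmor A B) (S S' : dalg B)
  (h : dhom S S') : dhom (res f S) (res f S') :=
  @DHom A (res f S) (res f S') h (res_hom_str f h).

(* Bare data: functoriality, naturality and the group axioms are part of
   [is_formal_group_scheme]. *)
Record group_functor (A : comUnitRingType) := GroupFunctor {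
  pts :> dalg A -> Type;
  pmap : forall S S' : dalg A, dhom S S' -> pts S -> pts S';
  pzero : forall S, pts S;
  padd : forall S, pts S -> pts S -> pts S
}.
Arguments pmap {A} g {S S'}.
Arguments pzero {A} g S.
Arguments padd {A} g {S}.

Record category := Category {
  Ob :> Type;
  Mor : Ob -> Ob -> Type;
  idm : forall i, Mor i i;
  compm : forall i j l, Mor j l -> Mor i j -> Mor i l;
  compm1 : forall i j (f : Mor i j), compm f (idm i) = f;
  comp1m : forall i j (f : Mor i j), compm (idm j) f = f;
  compmA : forall i j l m (f : Mor l m) (g : Mor j l) (h : Mor i j),
    compm f (compm g h) = compm (compm f g) h
}.

Definition filtered (I : category) : Prop :=
  [/\ inhabited I,
      forall i j : I, exists l, inhabited (Mor i l) /\ inhabited (Mor j l) &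
      forall (i j : I) (f g : Mor i j),
        exists l (h : Mor j l), compm h f = compm h g].

Section FormalGroupScheme.
Variables (A : comUnitRingType) (X : group_functor A).

Definition is_functor : Prop :=
  (forall S (f : dhom S S), (forall x, f x = x) -> forall a, pmap X f a = a) /\
  (forall S S' S'' (f : dhom S S') (g : dhom S' S'') (h : dhom S S''),
     (forall x, h x = g (f x)) -> forall a, pmap X h a = pmap X g (pmap X f a)).

(* X is the colimit of the affine schemes spec (B i), i in a filtered category;
   [d f] is the ring map of spec (B i) -> spec (B j) for f : i -> j, and
   [x i] is the point corresponding to spec (B i) -> X. *)
Definition is_formal_scheme : Prop :=
  exists (I : category) (B : I -> dalg A)
    (d : forall i j : I, Mor i j -> dhom (B j) (B i)) (x : forall i, X (B i)),
  [/\ filtered I,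
      (forall i b, d i i (idm i) b = b) /\
      (forall i j l (g : Mor j l) (f : Mor i j) b,
         d _ _ (compm g f) b = d _ _ f (d _ _ g b)),
      forall i j (f : Mor i j), pmap X (d _ _ f) (x j) = x i,
      forall S (a : X S), exists i (h : dhom (B i) S), pmap X h (x i) = a &
      forall S i j (h : dhom (B i) S) (h' : dhom (B j) S),
        pmap X h (x i) = pmap X h' (x j) ->
        exists l (f : Mor i l) (g : Mor j l),
          forall b, h (d _ _ f b) = h' (d _ _ g b)].

Definition is_formal_group_scheme : Prop :=
  [/\ is_functor,
      is_formal_scheme,
      (forall S S' (f : dhom S S'), pmap X f (pzero X S) = pzero X S') /\
      (forall S S' (f : dhom S S') (a b : X S),
         pmap X f (padd X a b) = padd X (pmap X f a) (pmap X f b)) &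
      forall S, [/\ associative (@padd A X S), commutative (@padd A X S),
                    left_id (pzero X S) (@padd A X S) &
                    forall a : X S, exists b, padd X b a = pzero X S]].

End FormalGroupScheme.

Definition is_hom (A : comUnitRingType) (X Y : group_functor A)
    (f : forall S, X S -> Y S) : Prop :=
  [/\ forall S S' (h : dhom S S') a, f S' (pmap X h a) = pmap Y h (f S a),
      forall S, f S (pzero X S) = pzero Y S &
      forall S (a b : X S), f S (padd X a b) = padd Y (f S a) (f S b)].

Definition base_change (A B : comUnitRingType) (f : cmor A B)
    (X : group_functor A) : group_functor B :=
  GroupFunctor (pts := fun S => X (res f S))
    (fun S S' h => pmap X (res_hom f h))
    (fun S => pzero X (res f S)) (fun S => @padd A X (res f S)).

Section FiberProduct.
Variables (A : comUnitRingType) (X Y Z : group_functor A).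
Variables (f : forall S, X S -> Z S) (g : forall S, Y S -> Z S).
Hypotheses (fP : is_hom f) (gP : is_hom g).

Record fib_pts (S : dalg A) := FibPts {
  fib1 : X S; fib2 : Y S; fibP : f fib1 = g fib2
}.

Lemma fib_map_subproof S S' (h : dhom S S') (a : fib_pts S) :
  f (pmap X h (fib1 a)) = g (pmap Y h (fib2 a)).
Proof. by case: fP gP => fn _ _ [gn _ _]; rewrite fn gn fibP. Qed.

Lemma fib_zero_subproof S : f (pzero X S) = g (pzero Y S).
Proof. by case: fP gP => _ f0 _ [_ g0 _]; rewrite f0 g0. Qed.

Lemma fib_add_subproof S (a b : fib_pts S) :
  f (padd X (fib1 a) (fib1 b)) = g (padd Y (fib2 a) (fib2 b)).
Proof. by case: fP gP => _ _ fD [_ _ gD]; rewrite fD gD !fibP. Qed.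

Definition fiber_product : group_functor A :=
  GroupFunctor (pts := fib_pts)
    (fun S S' h a => FibPts (fib_map_subproof h a))
    (fun S => FibPts (fib_zero_subproof S))
    (fun S a b => FibPts (fib_add_subproof a b)).

End FiberProduct.

(* The S-points of spec K^A (the product K^A has the product topology), for a
   K-algebra S: a K-algebra map K^A -> S killing the functions that vanish on
   some finite subset of A amounts to the images of the indicator functions of
   the elements of A. *)
Record const_pts (A : choiceType) (S : comPzRingType) := ConstPts {
  cval :> A -> S;
  cval_fin : finite_set [set a | cval a != 0];
  cval_orth : forall a b, a != b -> cval a * cval b = 0;
  cval_sum : \sum_(a \in [set: A]) cval a = 1
}.

Lemma const_ptsP (A : choiceType) (S : comPzRingType) (e f : const_pts A S) :
  cval e =1 cval f -> e = f.
Proof.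
case: e f => [e e1 e2 e3] [f f1 f2 f3] /= /funext ef.
by move: f1 f2 f3; rewrite -ef => f1 f2 f3; congr ConstPts; exact: Prop_irrelevance.
Qed.

Lemma fsumE (I : choiceType) (V : nmodType) (r : seq I) (P : set I) (F : I -> V) :
  uniq r -> (forall i, F i != 0 -> i \in r) ->
  \sum_(i \in P) F i = \sum_(i <- r | i \in P) F i.
Proof.
move=> ur rF; rewrite [RHS]bigfs ?set_mem_set // => i _ ri.
by apply/eqP; apply: contraNT ri => /rF.
Qed.

Lemma const_pts_seq (A : choiceType) (S : comPzRingType) (e : const_pts A S) :
  exists2 r : seq A, uniq r & forall a, cval e a != 0 -> a \in r.
Proof.
have /finite_fsetP [D eD] := cval_fin e.
exists (enum_fset D); first exact: fset_uniq.
by move=> a ea; have: [set a | cval e a != 0] a by []; rewrite eD.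
Qed.

Section ConstMap.
Variables (A : choiceType) (S S' : comPzRingType) (h : {rmorphism S -> S'}).

Lemma const_map_fin (e : const_pts A S) : finite_set [set a | h (e a) != 0].
Proof.
apply: sub_finite_set (cval_fin e) => a /=.
by apply: contraNneq => ->; rewrite rmorph0.
Qed.

Lemma const_map_orth (e : const_pts A S) a b : a != b -> h (e a) * h (e b) = 0.
Proof. by move=> ab; rewrite -rmorphM cval_orth // rmorph0. Qed.

Lemma rmorph_const_sum (e : const_pts A S) (P : set A) :
  h (\sum_(a \in P) e a) = \sum_(a \in P) h (e a).
Proof.
have [r ur rP] := const_pts_seq e.
rewrite !(@fsumE _ _ r) // ?rmorph_sum // => a hea.
by apply: rP; apply: contraNneq hea => ->; rewrite rmorph0.
Qed.

Lemma const_map_sum (e : const_pts A S) : \sum_(a \in [set: A]) h (e a) = 1.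
Proof. by rewrite -rmorph_const_sum cval_sum rmorph1. Qed.

Definition const_map (e : const_pts A S) : const_pts A S' :=
  ConstPts (const_map_fin e) (@const_map_orth e) (const_map_sum e).
End ConstMap.

Section ConstDelta.
Variables (A : choiceType) (S : comPzRingType) (a0 : A).
Let delta (a : A) : S := (a == a0)%:R.

Let delta_fin : finite_set [set a | delta a != 0].
Proof.
apply: sub_finite_set (finite_set1 a0) => a /=; rewrite /delta.
by case: (a =P a0) => //= _; rewrite eqxx.
Qed.

Let delta_orth a b : a != b -> delta a * delta b = 0.
Proof.
rewrite /delta => ab; case: (eqVneq a a0) ab => [->|_ _]; last by rewrite mul0r.
by rewrite eq_sym => /negPf ->; rewrite mulr0.
Qed.

Let delta_sum : \sum_(a \in [set: A]) delta a = 1.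
Proof.
rewrite (@fsumE _ _ [:: a0]) // => [|a]; last first.
  by rewrite /delta inE; case: (a =P a0) => //= _; rewrite eqxx.
by rewrite big_cons big_nil in_setT addr0 /delta eqxx.
Qed.

Definition const_delta : const_pts A S := ConstPts delta_fin delta_orth delta_sum.
End ConstDelta.

Section ConstPush.
Variables (A B : choiceType) (S : comPzRingType) (u : A -> B).
Variable e : const_pts A S.
Let push (b : B) : S := \sum_(a \in u @^-1` [set b]) e a.

Let pushE r : uniq r -> (forall a, e a != 0 -> a \in r) -> forall b,
  push b = \sum_(a <- r | u a == b) e a.
Proof.
move=> ur rP b; rewrite /push (@fsumE _ _ r) //; apply: eq_bigl => a.
by apply/idP/eqP; rewrite inE.
Qed.

Let push_fin : finite_set [set b | push b != 0].
Proof.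
have [r ur rP] := const_pts_seq e.
apply: sub_finite_set (finite_seq (map u r)) => b /=.
rewrite (pushE ur rP) => eb; apply: contraNT eb => /mapP br.
rewrite big_seq_cond big1 // => a /andP[ar /eqP uab].
by case: br; exists a.
Qed.

Let push_orth b b' : b != b' -> push b * push b' = 0.
Proof.
move=> bb'; have [r ur rP] := const_pts_seq e.
rewrite !(pushE ur rP) big_distrlr big1 //= => a /eqP uab.
rewrite big1 // => a' /eqP uab'; apply: cval_orth.
by apply: contraNneq bb' => aa'; rewrite -uab -uab' aa'.
Qed.

Let push_sum : \sum_(b \in [set: B]) push b = 1.
Proof.
have [r ur rP] := const_pts_seq e.
rewrite -(cval_sum e) (@fsumE _ _ r) // (@fsumE _ _ (undup (map u r))).
- under eq_bigl do rewrite in_setT.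
  under [RHS]eq_bigl do rewrite in_setT.
  under eq_bigr => b _ do rewrite (pushE ur rP) big_mkcond.
  rewrite exchange_big [LHS]big_seq [RHS]big_seq /=; apply: eq_bigr => a ar.
  rewrite (bigD1_seq (u a)) ?undup_uniq ?mem_undup ?map_f //= eqxx.
  by rewrite big1 ?addr0 // => b; rewrite eq_sym => /negPf ->.
- exact: undup_uniq.
- move=> b; rewrite mem_undup (pushE ur rP) => eb; apply: contraNT eb => /mapP br.
  rewrite big_seq_cond big1 // => a /andP[ar /eqP uab].
  by case: br; exists a.
Qed.

Definition const_push : const_pts B S := ConstPts push_fin push_orth push_sum.

Lemma const_pushE r : uniq r -> (forall a, e a != 0 -> a \in r) -> forall b,
  const_push b = \sum_(a <- r | u a == b) e a.
Proof. exact: pushE. Qed.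
End ConstPush.

Section ConstTensor.
Variables (A B : choiceType) (S : comPzRingType).
Variables (e : const_pts A S) (f : const_pts B S).
Let tens (ab : A * B) : S := e ab.1 * f ab.2.

Let tens_supp r s : (forall a, e a != 0 -> a \in r) ->
  (forall b, f b != 0 -> b \in s) ->
  forall ab, tens ab != 0 -> ab \in [seq (a, b) | a <- r, b <- s].
Proof.
move=> rP sP [a b]; rewrite /tens /= => ab0; apply/allpairsP; exists (a, b).
by split=> //=; [apply: rP | apply: sP]; apply: contraNneq ab0 => ->;
  rewrite ?mul0r ?mulr0.
Qed.

Let tens_fin : finite_set [set ab | tens ab != 0].
Proof.
have [r _ rP] := const_pts_seq e; have [s _ sP] := const_pts_seq f.
apply: sub_finite_set (finite_seq [seq (a, b) | a <- r, b <- s]) => ab.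
exact: tens_supp.
Qed.

Let tens_orth ab ab' : ab != ab' -> tens ab * tens ab' = 0.
Proof.
rewrite /tens mulrACA -pair_eqE /= negb_and.
by case/orP => ne; [rewrite (cval_orth e ne) mul0r | rewrite (cval_orth f ne) mulr0].
Qed.

Let tens_sum : \sum_(ab \in [set: A * B]) tens ab = 1.
Proof.
have [r ur rP] := const_pts_seq e; have [s us sP] := const_pts_seq f.
rewrite (@fsumE _ _ [seq (a, b) | a <- r, b <- s]).
- under eq_bigl do rewrite in_setT.
  rewrite big_allpairs /tens /=.
  under eq_bigr do rewrite -big_distrr /=.
  rewrite -big_distrl /= -[RHS]mulr1 -{1}(cval_sum e) -(cval_sum f).
  rewrite (@fsumE _ _ r) // (@fsumE _ _ s) //; congr (_ * _).
  + by apply: eq_bigl => a; rewrite in_setT.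
  + by apply: eq_bigl => a; rewrite in_setT.
- by apply: allpairs_uniq => // -[? ?] [? ?].
- exact: tens_supp.
Qed.

Definition const_tens : const_pts (A * B)%type S :=
  ConstPts tens_fin tens_orth tens_sum.
End ConstTensor.

(* For spec S connected, the function e is the indicator of some a, and
   [const_add] adds these elements. *)
Definition const_add (A : zmodType) (S : comPzRingType) (e f : const_pts A S) :
  const_pts A S := const_push (fun ab => ab.1 + ab.2) (const_tens e f).

Definition const_gs (K : comUnitRingType) (A : zmodType) : group_functor K :=
  GroupFunctor (pts := fun S => const_pts A S)
    (fun S S' h => const_map h) (fun S => const_delta S 0)
    (fun S => @const_add A S).

Lemma const_push_delta (A B : choiceType) (S : comPzRingType) (u : A -> B) a :
  const_push u (const_delta S a) = const_delta S (u a).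
Proof.
apply: const_ptsP => b; rewrite (@const_pushE _ _ _ _ _ [:: a]) //=.
  by rewrite big_cons big_nil eqxx eq_sym; case: eqP => //= _; rewrite addr0.
by move=> a'; rewrite inE; case: (a' =P a) => //= _; rewrite eqxx.
Qed.

Lemma const_push_map (A B : choiceType) (S S' : comPzRingType) (u : A -> B)
    (h : {rmorphism S -> S'}) (e : const_pts A S) :
  const_push u (const_map h e) = const_map h (const_push u e).
Proof. by apply: const_ptsP => b /=; rewrite rmorph_const_sum. Qed.

Lemma const_push_comp (A B C : choiceType) (S : comPzRingType) (u : A -> B)
    (v : B -> C) (e : const_pts A S) :
  const_push v (const_push u e) = const_push (v \o u) e.
Proof.
apply: const_ptsP => c; have [r ur rP] := const_pts_seq e.
rewrite (const_pushE _ ur rP) (@const_pushE _ _ _ _ _ (undup (map u r))).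
- under eq_bigr => b _ do rewrite (const_pushE u ur rP) big_mkcond.
  rewrite exchange_big /= [LHS]big_seq [RHS]big_seq_cond [RHS]big_mkcondr /=.
  apply: eq_bigr => a ar.
  rewrite big_mkcond (bigD1_seq (u a)) ?undup_uniq ?mem_undup ?map_f //= eqxx.
  rewrite big1 ?addr0 // => b; rewrite eq_sym => /negPf ->.
  by case: ifP.
- exact: undup_uniq.
- move=> b; rewrite (const_pushE u ur rP) mem_undup => eb.
  apply: contraNT eb => /mapP br.
  rewrite big_seq_cond big1 // => a /andP[ar /eqP uab].
  by case: br; exists a.
Qed.

Lemma const_push_tens (A B A' B' : choiceType) (S : comPzRingType)
    (u : A -> A') (v : B -> B') (e : const_pts A S) (f : const_pts B S) :
  const_push (fun ab => (u ab.1, v ab.2)) (const_tens e f) =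
  const_tens (const_push u e) (const_push v f).
Proof.
apply: const_ptsP => -[a' b'].
have [r ur rP] := const_pts_seq e; have [s us sP] := const_pts_seq f.
rewrite (@const_pushE _ _ _ _ _ [seq (a, b) | a <- r, b <- s]).
- transitivity (const_push u e a' * const_push v f b'); last by [].
  rewrite (const_pushE u ur rP) (const_pushE v us sP) big_distrlr /=.
  rewrite big_mkcond big_allpairs [RHS]big_mkcond /=; apply: eq_bigr => a _.
  case: ifP => ua; last by rewrite big1 // => b _; rewrite -pair_eqE /= ua.
  by rewrite [RHS]big_mkcond /=; apply: eq_bigr => b _; rewrite -pair_eqE /= ua.
- by apply: allpairs_uniq => // -[? ?] [? ?].
- move=> [a b] /= ab0; apply/allpairsP; exists (a, b).
  by split=> //=; [apply: rP | apply: sP]; apply: contraNneq ab0 => ->;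
    rewrite ?mul0r ?mulr0.
Qed.

Lemma const_push_add (A B : zmodType) (S : comPzRingType)
    (u : {additive A -> B}) (e f : const_pts A S) :
  const_push u (const_add e f) = const_add (const_push u e) (const_push u f).
Proof.
rewrite /const_add const_push_comp -const_push_tens const_push_comp.
by congr const_push; apply/funext => -[a b] /=; rewrite raddfD.
Qed.

Lemma const_push_hom (K : comUnitRingType) (A B : zmodType)
    (u : {additive A -> B}) :
  @is_hom K (const_gs K A) (const_gs K B) (fun S => const_push u).
Proof.
split=> [S S' h e|S|S e f]; first exact: const_push_map.
- by rewrite /= const_push_delta raddf0.
- exact: const_push_add.
Qed.
Definition frac (x : rat) : rat := x - (Num.floor x)%:~R.

Lemma frac_itv x : 0 <= frac x < 1.
Proof.
have /andP[lo hi] := Num.Theory.floor_itv x.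
by rewrite /frac subr_ge0 lo ltrBlDl -[X in _ + X]/(1%:~R) -intrD.
Qed.

Lemma frac_id x : 0 <= x < 1 -> frac x = x.
Proof. by move=> x01; rewrite /frac (@Num.Theory.floor_def _ x 0) // mulr0z subr0. Qed.

Lemma fracDz x (m : int) : frac (x + m%:~R) = frac x.
Proof.
rewrite /frac (@Num.Theory.floor_def _ (x + m%:~R) (Num.floor x + m)).
  by rewrite rmorphD /= opprD addrACA subrr addr0.
have /andP[lo hi] := Num.Theory.floor_itv x.
by rewrite addrAC !(rmorphD _ _ m) /= lerD2r lo ltrD2r.
Qed.

Lemma frac_fracl x y : frac (frac x + y) = frac (x + y).
Proof. by rewrite {2}/frac addrAC -rmorphN fracDz. Qed.

Lemma frac_fracr x y : frac (x + frac y) = frac (x + y).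
Proof. by rewrite addrC frac_fracl addrC. Qed.

(* Q/Z, represented by the rationals in [0,1). *)
Record QZ := MkQZ { qz :> rat; qzP : 0 <= qz < 1 }.
HB.instance Definition _ := [isSub for qz].
HB.instance Definition _ := [Choice of QZ by <:].

Definition QZ_of (x : rat) : QZ := MkQZ (frac_itv x).
Definition QZ_add (a b : QZ) : QZ := QZ_of (qz a + qz b).

Fact QZ_addA : associative QZ_add.
Proof.
by move=> a b c; apply: val_inj; rewrite /= frac_fracr frac_fracl addrA.
Qed.
Fact QZ_addC : commutative QZ_add.
Proof. by move=> a b; apply: val_inj; rewrite /= addrC. Qed.
Fact QZ_add0 : left_id (QZ_of 0) QZ_add.
Proof.
by move=> a; apply: val_inj; rewrite /= frac_fracl add0r frac_id ?qzP.
Qed.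
Fact QZ_addN : left_inverse (QZ_of 0) (fun a => QZ_of (- qz a)) QZ_add.
Proof. by move=> a; apply: val_inj; rewrite /= frac_fracl addNr. Qed.

HB.instance Definition _ :=
  GRing.isZmodule.Build QZ QZ_addA QZ_addC QZ_add0 QZ_addN.

(* Q_p/Z_p = Z[1/p]/Z as a subgroup of Q/Z. *)
Definition p_denom (p : nat) : {pred QZ} := fun a => p.-nat `|denq (qz a)|%N.

Lemma p_natP p (x : rat) :
  reflect (exists2 m : nat, p.-nat m & m%:R * x \is a Num.int)
          (p.-nat `|denq x|%N).
Proof.
apply: (iffP idP) => [px|[m pm /intrP[z mx]]].
  exists `|denq x|%N => //; apply/intrP; exists (numq x).
  by rewrite numqE mulrC pmulrn absz_denq.
apply: (pnat_dvd _ pm).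
have : (denq x %| m%:Z * numq x)%Z.
  apply/dvdzP; exists z; apply: (@intr_inj rat).
  by rewrite !intrM numqE -mx -pmulrn mulrA.
by rewrite Gauss_dvdzl // coprimezE coprime_sym coprime_num_den.
Qed.

Fact p_denom_zmod p : zmod_closed (p_denom p).
Proof.
have fracP x : p.-nat `|denq x|%N -> p.-nat `|denq (frac x)|%N.
  move=> /p_natP[m pm mx]; apply/p_natP; exists m => //.
  by rewrite mulrBr rpredB // rpredM // ?natr_int // intr_int.
split=> [|a b]; first exact: fracP.
move=> /p_natP[m pm ma] /p_natP[n pn nb].
rewrite -[_ \in _]/(p.-nat `|denq (frac (qz a + frac (- qz b)))|%N) frac_fracr.
apply/fracP/p_natP; exists (m * n)%N; first by rewrite pnatM pm.
by rewrite natrM mulrBr {1}mulrAC mulrC -mulrA rpredB // -?mulrA rpredM // natr_int.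
Qed.
HB.instance Definition _ p := GRing.isZmodClosed.Build QZ (p_denom p) (p_denom_zmod p).

Record QpZp (p : nat) := MkQpZp { qpzp :> QZ; qpzpP : p_denom p qpzp }.
HB.instance Definition _ p := [isSub for @qpzp p].
HB.instance Definition _ p := [Choice of QpZp p by <:].
HB.instance Definition _ p := [SubChoice_isSubZmodule of QpZp p by <:].

(* For c = fgl_coef, the series is F(x, y) = \sum_(i, j) c i j * x^i * y^j; the
   three axioms are F(x, 0) = x, F(x, y) = F(y, x) and
   F(F(x, y), z) = F(x, F(y, z)), the last one compared at x^a y^b z^d.  As
   F(0, 0) = 0, the series F^i has no term of total degree less than i. *)
Record fgl (E : comUnitRingType) := FGL {
  fgl_ser :> fps (fps E);
  fgl_coef := fun i j => fcoef (fcoef fgl_ser i) j;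
  fgl_unit : forall i, fgl_coef i 0 = (i == 1%N)%:R;
  fgl_comm : forall i j, fgl_coef i j = fgl_coef j i;
  fgl_assoc : forall a b d,
    \sum_(i < (a + b).+1) fgl_coef i d * fcoef (fcoef (fgl_ser ^+ i) a) b =
    \sum_(j < (b + d).+1) fgl_coef a j * fcoef (fcoef (fgl_ser ^+ j) b) d
}.

Definition nilpotent (S : comPzRingType) (x : S) : Prop := exists n, x ^+ n = 0.

Section Nilpotent.
Variable S : comPzRingType.
Implicit Types x y : S.

Lemma nilpotent0 : nilpotent (0 : S).
Proof. by exists 1%N; rewrite expr1. Qed.

Lemma nilpotentM a x : nilpotent x -> nilpotent (a * x).
Proof. by case=> n xn; exists n; rewrite exprMn xn mulr0. Qed.

Lemma nilpotentX x n : (0 < n)%N -> nilpotent x -> nilpotent (x ^+ n).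
Proof. by case: n => // n _ nx; rewrite exprSr; apply: nilpotentM. Qed.

Lemma nilpotentD x y : nilpotent x -> nilpotent y -> nilpotent (x + y).
Proof.
move=> [n xn] [m ym]; exists (n + m)%N; rewrite exprDn big1 // => i _.
case: (leqP m i) => [mi|im].
  by rewrite -(subnKC mi) exprD ym mul0r mulr0 mul0rn.
by rewrite -addnBA ?(ltnW im) // exprD xn !mul0r mul0rn.
Qed.

Lemma nilpotent_fsum (I : choiceType) (P : set I) (F : I -> S) :
  (forall i, nilpotent (F i)) -> nilpotent (\sum_(i \in P) F i).
Proof.
by move=> nF; elim/big_ind: _ => //; [exact: nilpotent0 | exact: nilpotentD].
Qed.
End Nilpotent.

Record nilp (S : comPzRingType) := Nilp { nval :> S; nvalP : nilpotent nval }.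

Section FormalGroup.
Variables (E : comUnitRingType) (F : fgl E).

(* The series -_F x, that is the unique i(x) with i(0) = 0 and F(x, i(x)) = 0;
   the second condition is compared at x^n. *)
Definition fgl_opp : fps E :=
  xget 0 [set f | fcoef f 0 = 0 /\
    forall n, \sum_(i < n.+1) \sum_(j < n.+1)
      fgl_coef F i j * fcoef (f ^+ j) (n - i) = 0].

Lemma fgl_opp0 : fcoef fgl_opp 0 = 0.
Proof. by rewrite /fgl_opp; case: xgetP => // f _ []. Qed.

Variable S : dalg E.

(* These sums have finite support, as x and y are nilpotent. *)
Definition nilp_add_val (x y : S) : S :=
  \sum_(ij \in [set: nat * nat])
    da_str S (fgl_coef F ij.1 ij.2) * x ^+ ij.1 * y ^+ ij.2.

Definition nilp_opp_val (x : S) : S :=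
  \sum_(n \in [set: nat]) da_str S (fcoef fgl_opp n) * x ^+ n.

Lemma nilp_add_subproof (x y : nilp S) : nilpotent (nilp_add_val x y).
Proof.
apply: nilpotent_fsum => -[[|i] [|j]] /=; last 3 first.
- by apply: nilpotentM; apply: nilpotentX => //; apply: nvalP.
- by rewrite mulr1; apply: nilpotentM; apply: nilpotentX => //; apply: nvalP.
- by apply: nilpotentM; apply: nilpotentX => //; apply: nvalP.
by rewrite fgl_unit rmorph0 !mul0r; apply: nilpotent0.
Qed.

Lemma nilp_opp_subproof (x : nilp S) : nilpotent (nilp_opp_val x).
Proof.
apply: nilpotent_fsum => -[|n].
  by rewrite fgl_opp0 rmorph0 mul0r; apply: nilpotent0.
by apply: nilpotentM; apply: nilpotentX => //; apply: nvalP.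
Qed.

Definition nilp0 : nilp S := Nilp (nilpotent0 S).
Definition nilp_add (x y : nilp S) : nilp S := Nilp (nilp_add_subproof x y).
Definition nilp_opp (x : nilp S) : nilp S := Nilp (nilp_opp_subproof x).
End FormalGroup.

Lemma nilp_map_subproof (S S' : comPzRingType) (h : {rmorphism S -> S'})
  (x : nilp S) : nilpotent (h (nval x)).
Proof. by have [n xn] := nvalP x; exists n; rewrite -rmorphXn xn rmorph0. Qed.

Definition nilp_map (S S' : comPzRingType) (h : {rmorphism S -> S'})
  (x : nilp S) : nilp S' := Nilp (nilp_map_subproof h x).

(* The formal group Spf E[[x]] of F: a point over a discrete algebra is the
   value of the coordinate x, a nilpotent element. *)
Definition formal_group (E : comUnitRingType) (F : fgl E) : group_functor E :=
  GroupFunctor (pts := fun S => nilp S)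
    (fun S S' h => nilp_map h) (@nilp0 E) (@nilp_add E F).

Section Tate.
Variables (E : comUnitRingType) (F : fgl E).

Lemma fpsC_continuous : adic_continuous (@fpsC E).
Proof. exact: local_continuous. Qed.

Definition fpsC_cmor : cmor E (fps E) := CMor fpsC_continuous.

Section TatePoints.
Variable S : dalg (fps E).

Lemma qhat_subproof : nilpotent (da_str S (fpsX E)).
Proof.
have [n Sn] := da_disc S; exists n; rewrite -rmorphXn Sn //.
by apply: maxpow_exp; rewrite -[_ \is a _]/(fcoef (fpsX E) 0 \is a GRing.unit) unitr0.
Qed.

(* A point of the disjoint union of copies of F_R indexed by Q/Z = Q `&` [0,1):
   the idempotent [a.2 c] is the locus where the point is in the copy F_R x {c},
   and a.1 is its first component. *)
Definition tate_pts : Type := (base_change fpsC_cmor (formal_group F) S * const_pts QZ S)%type.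

(* The idempotent of the locus where a + b >= 1. *)
Definition carry (e f : const_pts QZ S) : S :=
  \sum_(ab \in [set ab : QZ * QZ | 1 <= qz ab.1 + qz ab.2]) e ab.1 * f ab.2.

(* The point of F_R equal to qhat where a + b >= 1, and to 0 elsewhere. *)
Definition carry_qhat (e f : const_pts QZ S) : nilp S :=
  Nilp (nilpotentM (carry e f) qhat_subproof).

Definition tate_add (x y : tate_pts) : tate_pts :=
  let S' := res fpsC_cmor S in
  (@nilp_add E F S' (@nilp_add E F S' x.1 y.1)
     (@nilp_opp E F S' (carry_qhat x.2 y.2)),
   const_add x.2 y.2).

End TatePoints.

Definition tate : group_functor (fps E) :=
  GroupFunctor (pts := tate_pts)
    (fun S S' h x => (nilp_map h x.1, const_map h x.2))
    (fun S => (nilp0 S, const_delta S 0)) tate_add.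

Definition tate_proj (S : dalg (fps E)) (x : tate S) : const_gs (fps E) QZ S := x.2.

Lemma tate_proj_hom : is_hom tate_proj.
Proof. by []. Qed.

End Tate.
Record exseq (K : comUnitRingType) (A : zmodType) (G : group_functor K) := ExSeq {
  ex_mid : group_functor K;
  ex_inc : forall S, G S -> ex_mid S;
  ex_proj : forall S, ex_mid S -> const_gs K A S
}.

Section Ext.
Variables (K : comUnitRingType) (A : zmodType) (G : group_functor K).
Implicit Types X Y : exseq A G.

(* Exactness is exactness on S-points for every S; equivalently, the map of
   formal schemes underlying X -> A_K has a section and G is its kernel. *)
Definition is_extension X : Prop :=
  [/\ is_formal_group_scheme (ex_mid X),
      is_hom (@ex_inc _ _ _ X) /\ is_hom (@ex_proj _ _ _ X),
      forall S, injective (@ex_inc _ _ _ X S),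
      forall S (x : ex_mid X S),
        ex_proj x = pzero (const_gs K A) S <-> exists g, ex_inc X g = x &
      forall S (a : const_gs K A S), exists x : ex_mid X S, ex_proj x = a].

Definition ext_iso X Y : Prop :=
  exists (f : forall S, ex_mid X S -> ex_mid Y S)
         (f' : forall S, ex_mid Y S -> ex_mid X S),
  [/\ is_hom f /\ is_hom f',
      forall S, cancel (f S) (f' S) /\ cancel (f' S) (f S),
      forall S (g : G S), f S (ex_inc X g) = ex_inc Y g &
      forall S (x : ex_mid X S), ex_proj (f S x) = ex_proj x].

Definition ext_class X : exseq A G -> Prop :=
  fun Y => is_extension Y /\ ext_iso X Y.

Definition Ext (C : exseq A G -> Prop) : Prop :=
  exists2 X, is_extension X & C = ext_class X.

End Ext.

Record complete_local_ring (k : fieldType) := CompleteLocalRing {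
  clr :> comUnitRingType;
  clr_res : {rmorphism clr -> k};
  clr_resP : residue_map clr_res;
  clr_complete : adic_complete clr
}.

Section TestRings.
Variables (k : fieldType) (E : complete_local_ring k).

Record test_ring := TestRing {
  tr :> comUnitRingType;
  tr_str : {rmorphism E -> tr};
  tr_artinian : artinian tr;
  tr_res : exists r : {rmorphism tr -> k},
    residue_map r /\ forall e, r (tr_str e) = clr_res E e
}.

Lemma tr_str_continuous (T : test_ring) : adic_continuous (tr_str T).
Proof.
apply: local_continuous => e; have [r [[_ rP] re]] := tr_res T.
by rewrite rP re -(clr_resP E).2.
Qed.

Definition tr_cmor (T : test_ring) : cmor E T := CMor (@tr_str_continuous T).

Record test_hom (T T' : test_ring) := TestHom {
  th_fun :> {rmorphism T -> T'};
  th_str : forall e, th_fun (tr_str T e) = tr_str T' e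
}.

Lemma test_hom_continuous (T T' : test_ring) (u : test_hom T T') :
  adic_continuous u.
Proof.
apply: local_continuous => t; have [r [[_ rP] re]] := tr_res T.
have [r' [[_ rP'] re']] := tr_res T'.
rewrite rP'; apply: contraTT => nt.
have [e /esym ute] := (clr_resP E).1 (r' (u t)).
have: ~~ ((t - tr_str T e) \is a GRing.unit).
  apply/negP => /(rmorph_unit u); rewrite rP' rmorphB rmorphB /= th_str re' ute.
  by rewrite subrr eqxx.
rewrite rP rmorphB re negbK; move: nt; rewrite rP negbK => /eqP ->.
by rewrite sub0r oppr_eq0 -ute negbK.
Qed.

Definition th_cmor (T T' : test_ring) (u : test_hom T T') : cmor T T' :=
  CMor (test_hom_continuous u).

Section ExtFunctor.
Variables (A : zmodType) (G : group_functor E).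

Definition ExtF (T : test_ring) :
    (exseq A (base_change (tr_cmor T) G) -> Prop) -> Prop :=
  Ext (A := A) (G := base_change (tr_cmor T) G).

Section BaseChange.
Variables (T T' : test_ring) (u : test_hom T T').

Lemma res_cmp_subproof (S : dalg T') (e : E) :
  idfun (da_str (res (tr_cmor T') S) e) =
  da_str (res (tr_cmor T) (res (th_cmor u) S)) e.
Proof. by rewrite /= th_str. Qed.

(* The canonical isomorphism G_T' -> (G_T)_T'. *)
Definition base_change_cmp (S : dalg T') :
    base_change (tr_cmor T') G S ->
    base_change (th_cmor u) (base_change (tr_cmor T) G) S :=
  pmap G (@DHom E (res (tr_cmor T') S) (res (tr_cmor T) (res (th_cmor u) S))
            idfun (res_cmp_subproof S)).

Definition exseq_base (X : exseq A (base_change (tr_cmor T) G)) :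
    exseq A (base_change (tr_cmor T') G) :=
  @ExSeq _ A (base_change (tr_cmor T') G) (base_change (th_cmor u) (ex_mid X))
    (fun S g => ex_inc X (base_change_cmp g))
    (fun S x => @ex_proj _ _ _ X (res (th_cmor u) S) x).

Definition ExtF_map (C : exseq A (base_change (tr_cmor T) G) -> Prop) :
    exseq A (base_change (tr_cmor T') G) -> Prop :=
  fun Y => is_extension Y /\ exists2 X, C X & ext_iso (exseq_base X) Y.

End BaseChange.
End ExtFunctor.

Record cont_hom (T : test_ring) := ContHom {
  ch_fun :> cmor (fps E) T;
  ch_str : forall e, ch_fun (fpsC e) = tr_str T e
}.

Lemma cont_hom_comp_str (T T' : test_ring) (u : test_hom T T') (f : cont_hom T) e :
  cmor_comp (th_cmor u) f (fpsC e) = tr_str T' e.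
Proof. by rewrite /= ch_str th_str. Qed.

Definition cont_hom_comp (T T' : test_ring) (u : test_hom T T') (f : cont_hom T) :
  cont_hom T' := ContHom (cont_hom_comp_str u f).

Section TateExtension.
Variables (p : nat) (F : fgl E) (T : test_ring) (f : cont_hom T).

Definition tateT : group_functor T := base_change f (tate F).

Definition tateT_proj (S : dalg T) (x : tateT S) : const_gs T QZ S :=
  @tate_proj E F (res f S) x.

Lemma tateT_proj_hom : is_hom tateT_proj.
Proof. by []. Qed.

Definition QpZp_incl (S : dalg T) : const_gs T (QpZp p) S -> const_gs T QZ S :=
  const_push (@qpzp p).

Lemma QpZp_incl_hom : is_hom QpZp_incl.
Proof. exact: (@const_push_hom T (QpZp p) QZ val). Qed.

Definition tate_mid : group_functor T :=
  fiber_product tateT_proj_hom QpZp_incl_hom.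

Lemma tate_inc_subproof (S : dalg T) (g : nilp S) :
  tateT_proj ((g, const_delta S 0) : tateT S) = QpZp_incl (const_delta S 0).
Proof. by rewrite /QpZp_incl const_push_delta. Qed.

Definition tate_inc (S : dalg T) (g : nilp S) : tate_mid S :=
  @FibPts T tateT (const_gs T (QpZp p)) (const_gs T QZ) tateT_proj QpZp_incl S
    (g, const_delta S 0) (const_delta S 0) (tate_inc_subproof g).

Definition tate_ext : exseq (QpZp p) (base_change (tr_cmor T) (formal_group F)) :=
  @ExSeq T (QpZp p) (base_change (tr_cmor T) (formal_group F)) tate_mid
    tate_inc (fun S x => fib2 x).

End TateExtension.
End TestRings.

Definition bijective_onto (X Y : Type) (f : X -> Y) (P : Y -> Prop) : Prop :=
  [/\ forall x, P (f x), injective f & forall y, P y -> exists x, f x = y].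

(* Main.v *)
(* Write q for the image of qhat in T.  As T is Artinian, its maximal ideal m is
   nilpotent, so every T-algebra is discrete and F(T) is killed by some p^N: by
   F(x, y) = x + y + x y (...), multiplication by p maps m^n to m^(n+1).

   Hence in an extension X of Q_p/Z_p by F_T, p^N times a lift of a/p^N does not
   depend on the lift.  This gives lifts s(a) in X(T), for a in [0,1), with
   s(a) + s(b) = s(a + b) + [a + b >= 1] c, where c in F(T) is p^N times a lift of
   1/p^N.  In Tate(F) one has s(a) = (0, a) and c = -q; so c determines q, which
   gives injectivity, and conversely X is compared to Tate(F) for q = -c through
   (g, a) |-> g + s(a).

   A point of Q_p/Z_p over S is constant only locally on spec S.  An X-point is
   determined locally, because this holds for F and for constant groups, and the
   locally defined s(a) glue after correcting some lift by a nilpotent element.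

   Finally, the total space of the Tate extension is a formal scheme because a
   functor that preserves products and equalizers is the filtered colimit of the
   representable functors indexed by its category of elements. *)

Require Import Defs.
From HB Require Import structures.
From mathcomp Require Import all_boot all_order all_algebra.
From mathcomp Require Import zify ring lra.
From mathcomp Require Import boolp classical_sets functions cardinality fsbigop.

Set Implicit Arguments.
Unset Strict Implicit.
Unset Printing Implicit Defensive.

Import Defs Order.TTheory GRing.Theory Num.Theory.
Local Open Scope ring_scope.

(** * Functors preserving products and equalizers *)

Lemma rmorphism_ext (R S : pzSemiRingType) (f g : {rmorphism R -> S}) :
  f =1 g -> f = g.
Proof.
case: f g => f cf [g cg] /= /funext fg; case: g / fg cg => cg.
congr GRing.RMorphism.Pack.
case: cf cg => [[cf1] [cf2]] [[cg1] [cg2]].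
by do ![f_equal]; apply: Prop_irrelevance.
Qed.

Lemma dhom_ext (A : comUnitRingType) (S S' : dalg A) (h h' : dhom S S') :
  h =1 h' -> h = h'.
Proof.
case: h h' => h hs [h' hs'] /= /rmorphism_ext hh'.
by case: h' / hh' hs' => hs'; congr DHom; apply: Prop_irrelevance.
Qed.

Section Elements.
Variable A : comUnitRingType.

Definition dhom_id (S : dalg A) : dhom S S := @DHom A S S idfun (fun=> erefl).

Lemma dhom_comp_str (S S' S'' : dalg A) (g : dhom S' S'') (f : dhom S S') a :
  (g \o f) (da_str S a) = da_str S'' a.
Proof. by rewrite /= !dh_str. Qed.

Definition dhom_comp (S S' S'' : dalg A) (g : dhom S' S'') (f : dhom S S') :
  dhom S S'' := DHom (dhom_comp_str g f).

(** Induction on [m] leaves the inclusion of the power $n+1$ of the maximal ideal in the power $n$.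
    That follows by induction on [n], since the product of ideals is monotone in its second
    factor. *)
Lemma maxpow_addn m n (x : A) : maxpow A (m + n) x -> maxpow A n x.
Proof.
elim: m n x => // m IH n x; rewrite addSnnS => /IH /=; move: n x {IH}.
elim=> [//|n IH] x.
case=> l [a [b [Ia Jb ->]]] /=; exists l, a, b; split=> // i; exact/IH/Jb.
Qed.

Section Prod.
Variables B C : dalg A.
Definition prod_str (a : A) : B * C := (da_str B a, da_str C a).
Fact prod_str_zmod : zmod_morphism prod_str.
Proof. by move=> a b; rewrite /prod_str !rmorphB. Qed.
Fact prod_str_monoid : monoid_morphism prod_str.
Proof. by rewrite /prod_str; split=> [|a b]; rewrite ?rmorph1 ?rmorphM. Qed.
HB.instance Definition _ := GRing.isZmodMorphism.Build A (B * C)%type prod_str prod_str_zmod.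
HB.instance Definition _ :=
  GRing.isMonoidMorphism.Build A (B * C)%type prod_str prod_str_monoid.

Lemma prod_disc : exists n, forall a, maxpow A n a -> prod_str a = 0.
Proof.
have [m Bm] := da_disc B; have [n Cn] := da_disc C; exists (m + n)%N => a am.
by rewrite /prod_str Cn ?Bm //; [apply: (@maxpow_addn n); rewrite addnC | apply: maxpow_addn am].
Qed.

Definition prod_dalg : dalg A := DAlg prod_disc.
Definition dfst : dhom prod_dalg B := @DHom A prod_dalg B fst (fun=> erefl).
Definition dsnd : dhom prod_dalg C := @DHom A prod_dalg C snd (fun=> erefl).
End Prod.

Section Equalizer.
Variables (B C : dalg A) (f g : dhom B C).

Definition equalizer_pred : {pred B} := fun b => f b == g b :> C.
Fact equalizer_subring : subring_closed equalizer_pred.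
Proof.
split=> [|x y /eqP fx /eqP fy|x y /eqP fx /eqP fy]; rewrite /equalizer_pred unfold_in.
- by rewrite !rmorph1.
- by rewrite !rmorphB fx fy.
- by rewrite !rmorphM fx fy.
Qed.
HB.instance Definition _ := GRing.isSubringClosed.Build B equalizer_pred equalizer_subring.

Record equalizer := Equalizer { eqz_val : B; eqz_valP : eqz_val \in equalizer_pred }.
HB.instance Definition _ := [isSub for eqz_val].
HB.instance Definition _ := [Choice of equalizer by <:].
HB.instance Definition _ := GRing.SubChoice_isSubComPzRing.Build B equalizer_pred equalizer
  (subringClosedP _).

Fact equalizer_str_subproof a : da_str B a \in equalizer_pred.
Proof. by rewrite unfold_in /= !dh_str. Qed.
Definition equalizer_str (a : A) : equalizer := Equalizer (equalizer_str_subproof a).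
Fact equalizer_str_zmod : zmod_morphism equalizer_str.
Proof. by move=> a b; apply: val_inj; rewrite rmorphB /= rmorphB. Qed.
Fact equalizer_str_monoid : monoid_morphism equalizer_str.
Proof.
by split=> [|a b]; apply: val_inj; rewrite ?rmorphM /= ?rmorph1 ?rmorphM.
Qed.
HB.instance Definition _ :=
  GRing.isZmodMorphism.Build A equalizer equalizer_str equalizer_str_zmod.
HB.instance Definition _ :=
  GRing.isMonoidMorphism.Build A equalizer equalizer_str equalizer_str_monoid.
Lemma equalizer_disc : exists n, forall a, maxpow A n a -> equalizer_str a = 0.
Proof.
have [n Bn] := da_disc B; exists n => a an.
by apply: val_inj; rewrite rmorph0 /= Bn.
Qed.
Definition equalizer_dalg : dalg A := DAlg equalizer_disc.
Definition equalizer_incl : dhom equalizer_dalg B :=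
  @DHom A equalizer_dalg B (val : {rmorphism equalizer -> B}) (fun=> erefl).
Lemma equalizer_inclP x : f (equalizer_incl x) = g (equalizer_incl x).
Proof. by apply/eqP; exact: eqz_valP. Qed.
End Equalizer.

(* The index category is the category of elements of X. *)
Lemma is_formal_scheme_of_lex (X : group_functor A) (S0 : dalg A) :
  is_functor X ->
  (forall B C (x : X B) (y : X C), exists z : X (prod_dalg B C),
     pmap X (dfst B C) z = x /\ pmap X (dsnd B C) z = y) ->
  (forall B C (f g : dhom B C) (x : X B), pmap X f x = pmap X g x ->
     exists z, pmap X (equalizer_incl f g) z = x) ->
  is_formal_scheme X.
Proof.
move=> [X1 XM] Xprod Xeq.
pose ob := {S : dalg A & X S}.
pose mor (i j : ob) := {h : dhom (projT1 j) (projT1 i) | pmap X h (projT2 j) = projT2 i}.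
have mor_ext i j (h h' : mor i j) : (forall b, sval h b = sval h' b) -> h = h'.
  case: h h' => h hP [h' hP'] /= /dhom_ext hh'; case: h' / hh' hP' => hP'.
  by congr exist; apply: Prop_irrelevance.
pose idm (i : ob) : mor i i := exist _ (dhom_id (projT1 i)) (X1 _ (dhom_id _) (fun=> erefl) _).
have compP (i j l : ob) (g : mor j l) (f : mor i j) :
    pmap X (dhom_comp (sval f) (sval g)) (projT2 l) = projT2 i.
  by case: f g => f fP [g gP] /=; rewrite (XM _ _ _ g f) // gP fP.
pose comp (i j l : ob) (g : mor j l) (f : mor i j) : mor i l := exist _ _ (compP i j l g f).
pose I := @Category ob mor idm comp
  (fun i j f => mor_ext i j (comp _ _ _ f (idm i)) f (fun=> erefl))
  (fun i j f => mor_ext i j (comp _ _ _ (idm j) f) f (fun=> erefl))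
  (fun i j l m f g h =>
     mor_ext i m (comp _ _ _ f (comp _ _ _ g h)) (comp _ _ _ (comp _ _ _ f g) h)
       (fun=> erefl)).
(* Arrows of the index category reverse ring maps, so a coequalizing arrow comes from the equalizer
   algebra, to which the point over [j] lifts. *)
have Xeq2 (i j : I) (f g : mor i j) : exists l (h : mor j l), comp _ _ _ h f = comp _ _ _ h g.
  have [|z zP] := Xeq _ _ (sval f) (sval g) (projT2 j).
    by rewrite (svalP f) (svalP g).
  pose l : I := existT _ (equalizer_dalg (sval f) (sval g)) z.
  exists l, (exist _ (equalizer_incl (sval f) (sval g)) zP : mor j l).
  by apply: (mor_ext _ _) => b; apply: equalizer_inclP.
exists I, (fun i : ob => projT1 i), (fun i j (h : mor i j) => sval h), (fun i : ob => projT2 i).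
split=> //.
- split=> [|i j|i j f g]; last exact: Xeq2.
    by constructor; exists S0; apply: pzero.
  have [z [zi zj]] := Xprod _ _ (projT2 i) (projT2 j).
  exists (existT _ (prod_dalg (projT1 i) (projT1 j)) z : ob).
  by split; constructor; [exists (dfst _ _) | exists (dsnd _ _)].
- by move=> i j [f fP].
- move=> S a; exists (existT _ S a : ob), (dhom_id S).
  exact: (X1 _ (dhom_id S)).
(* Both points come from one point [z] over the product. Its two images over [S] agree, so it lifts
   to a point [w] over the equalizer of the two maps to [S], and [w] is the required object. *)
- move=> S i j h h' hh'.
  have [z [zi zj]] := Xprod _ _ (projT2 i) (projT2 j).
  have hz : pmap X (dhom_comp h (dfst _ _)) z = pmap X (dhom_comp h' (dsnd _ _)) z.
    by rewrite (XM _ _ _ (dfst _ _) h) // (XM _ _ _ (dsnd _ _) h') // zi zj.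
  have [w wP] := Xeq _ _ _ _ _ hz.
  pose l : I := existT _ (equalizer_dalg _ _) w.
  pose incl := equalizer_incl (dhom_comp h (dfst _ _)) (dhom_comp h' (dsnd _ _)).
  have fP : pmap X (dhom_comp (dfst _ _) incl) w = projT2 i.
    by rewrite (XM _ _ _ (equalizer_incl _ _) (dfst _ _)) // wP.
  have gP : pmap X (dhom_comp (dsnd _ _) incl) w = projT2 j.
    by rewrite (XM _ _ _ (equalizer_incl _ _) (dsnd _ _)) // wP.
  exists l, (exist _ _ fP : mor i l), (exist _ _ gP : mor j l) => b.
  exact: (equalizer_inclP (f := dhom_comp h (dfst _ _)) (g := dhom_comp h' (dsnd _ _)) b).
Qed.
End Elements.

(** * Nilpotency of the maximal ideal *)

Section Artinian.
Variable A : comUnitRingType.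

Lemma maxpow_ideal n : is_ideal (maxpow A n).
Proof.
elim: n => [//|n [J0 JD JM]]; split=> /=.
- by exists 0%N, (fun=> 0), (fun=> 0); split=> [[]|[]|] //; rewrite big_ord0.
- move=> x y [l [a [b [Ia Jb ->]]]] [m [c [d [Ic Jd ->]]]].
  exists (l + m)%N,
    (fun i : 'I_(l + m) => match fintype.split i with inl i => a i | inr i => c i end),
    (fun i : 'I_(l + m) => match fintype.split i with inl i => b i | inr i => d i end).
  split=> [i|i|]; try by case: (fintype.split i).
  rewrite big_split_ord /=; congr (_ + _); apply: eq_bigr => i _.
    by case: fintype.splitP => j /= eqj; [congr (a _ * b _); apply: ord_inj
      | have := ltn_ord i; rewrite eqj ltnNge leq_addr].
  by case: fintype.splitP => j /= eqj; [have := ltn_ord j; rewrite -eqj ltnNge leq_addr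
    | congr (c _ * d _); apply: ord_inj; apply/eqP; rewrite -(eqn_add2l l) eqj].
- move=> c x [l [a [b [Ia Jb ->]]]]; exists l, a, (fun i => c * b i).
  split=> // [i|]; first exact: JM.
  by rewrite big_distrr; apply: eq_bigr => i _; rewrite mulrCA.
Qed.

Lemma maxpow_mul n x y : x \isn't a GRing.unit -> maxpow A n y ->
  maxpow A n.+1 (x * y).
Proof.
by move=> nx ny /=; exists 1%N, (fun=> x), (fun=> y); split; rewrite ?big_ord1.
Qed.

Lemma maxpow_le m n x : (m <= n)%N -> maxpow A n x -> maxpow A m x.
Proof. by move=> /subnK <-; apply: maxpow_addn. Qed.

Variables (k : fieldType) (r : {rmorphism A -> k}).
Hypotheses (rP : residue_map r) (artA : artinian A).

(** The powers of the maximal ideal $m$ stabilize at some $J = mJ$. If $J \neq 0$, there are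
    products $u_n$ of $n$ nonunits with $u_n J \neq 0$. The chain of ideals $A u_n$ stabilizes, so
    $u_M = a y u_M$ with $y$ a nonunit. As $1 - ay$ is a unit, $u_M = 0$, a contradiction. *)
Lemma maxpow_nilpotent : exists N, forall x, maxpow A N x -> x = 0.
Proof.
have [N NP] := artA maxpow_ideal (fun n x => @maxpow_addn A 1 n x).
exists N => x0 Jx0; apply/eqP/negPn/negP => x0n.
pose P x := exists2 j, maxpow A N j & x * j != 0.
(* As $J = mJ$, an element of $J$ not killed by [x] is a sum of products [a i * b i] with [a i] a
   nonunit and [b i] in $J$; some summand is not killed by [x]. *)
have step x : P x -> exists2 y, y \isn't a GRing.unit & P (x * y).
  move=> [j]; rewrite -(NP N.+1) // => -[l [a [b [Ia Jb ->]]]].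
  rewrite big_distrr /= => nz.
  have [i xi] : exists i, x * (a i * b i) != 0.
    apply/existsP; apply: contraNT nz; rewrite negb_exists => /forallP z.
    by rewrite big1 // => i _; apply/eqP; move: (z i); rewrite negbK.
  exists (a i); first exact: (Ia i).
  exists (b i); [exact: Jb | rewrite -mulrA; exact: xi].

pose st (x : {x | P x}) : {x | P x} :=
  let: exist2 y _ Py := cid2 (step _ (svalP x)) in exist _ _ Py.
have P1 : P 1 by exists x0; rewrite ?mul1r.
pose u n := sval (iter n st (exist _ 1 P1)).
have uS n : exists2 y, y \isn't a GRing.unit & u n.+1 = u n * y.
  by rewrite /u /= {1}/st; case: cid2 => y ny Py /=; exists y.
have uP n : P (u n) by exact: svalP.
pose I n : set A := fun z => exists a, z = a * u n.
have [||M MP] := artA (I := I).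
- move=> n; split=> [|x y [a ->] [b ->]|c x [a ->]].
  + by exists 0; rewrite mul0r.
  + by exists (a + b); rewrite mulrDl.
  + by exists (c * a); rewrite mulrA.
- by move=> n x [a ->]; have [y _ ->] := uS n; exists (a * y); rewrite mulrAC mulrA.
have : I M (u M) by exists 1; rewrite mul1r.
rewrite -(MP M.+1) // => -[a]; have [y ny ->] := uS M => e.
have {e} : (1 - a * y) * u M = 0.
  by rewrite mulrBl mul1r {1}e -[a * y * _]mulrA [y * _]mulrC subrr.
have [_ unitE] := rP.
have ua : (1 - a * y) \is a GRing.unit.
  move: ny; rewrite !unitE negbK => /eqP ry.
  by rewrite rmorphB rmorphM ry mulr0 rmorph1 subr0 oner_eq0.
move=> /(congr1 (fun z => (1 - a * y)^-1 * z)); rewrite mulKr // mulr0 => uM0.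
by have [j _] := uP M; rewrite uM0 mul0r eqxx.
Qed.
End Artinian.

(** * Idempotents and localization *)

Section ConstPoints.
Variables (I : choiceType) (S : comPzRingType) (u : const_pts I S).

Lemma cval_idem i : u i * u i = u i.
Proof.
have [r ur rP] := const_pts_seq u.
rewrite -[RHS]mulr1 -(cval_sum u) (@fsumE _ _ r) // big_distrr /=.
under eq_bigl do rewrite in_setT.
case: (boolP (i \in r)) => [ir|ir]; last first.
  have -> : u i = 0 by apply/eqP; apply: contraNT ir; apply: rP.
  by rewrite mul0r big1 // => j _; rewrite mul0r.
rewrite (bigD1_seq i) //= big1 ?addr0 // => j ji.
by rewrite cval_orth // eq_sym.
Qed.

Lemma cval_eq1 i : u i = 1 -> u = const_delta S i.
Proof.
move=> ui; apply: const_ptsP => j /=; case: eqVneq => [->//|ij].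
by rewrite -[LHS]mulr1 -ui cval_orth.
Qed.

Lemma cval_separated (x y : S) : (forall i, u i * x = u i * y) -> x = y.
Proof.
move=> xy; have [r ur rP] := const_pts_seq u.
rewrite -[x]mul1r -[y]mul1r -(cval_sum u) (@fsumE _ _ r) // !big_distrl /=.
exact: eq_bigr.
Qed.

(** The sum runs over a finite support of [u]. Orthogonality isolates the term at [i], and outside
    the support [g i = u i * g i] vanishes. *)
Lemma cval_glue (g : I -> S) : (forall i, u i * g i = g i) ->
  exists r : seq I, forall i, u i * (\sum_(j <- r) g j) = g i.
Proof.
move=> ug; have [r ur rP] := const_pts_seq u; exists r => i.
rewrite big_distrr /=; case: (boolP (i \in r)) => ir.
  rewrite (bigD1_seq i) //= big1 ?addr0 ?ug // => j ji.
  by rewrite -ug mulrA cval_orth ?mul0r // eq_sym.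
have ui0 : u i = 0 by apply/eqP; apply: contraNT ir; apply: rP.
by rewrite -[RHS]ug ui0 mul0r big1 // => j _; rewrite mul0r.
Qed.
End ConstPoints.

Lemma const_tens_eq1 (I J : choiceType) (S : comPzRingType) (u : const_pts I S)
    (v : const_pts J S) i j : const_tens u v (i, j) = 1 ->
  u = const_delta S i /\ v = const_delta S j.
Proof.
rewrite /= => uv; split; apply: cval_eq1.
  by rewrite -[LHS]mulr1 -uv mulrA cval_idem.
by rewrite -[LHS]mulr1 -uv mulrCA cval_idem.
Qed.

(* The localization S[1/e] at an idempotent e, realized as the subset e S. *)
Section IdemLoc.
Variables (A : comUnitRingType) (S : dalg A) (e : S) (ee : e * e = e).

Definition idem_pred : {pred S} := fun x => e * x == x.
Fact idem_zmod : zmod_closed idem_pred.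
Proof.
split=> [|x y /eqP ex /eqP ey]; rewrite unfold_in /=; first by rewrite mulr0.
by rewrite mulrBr ex ey.
Qed.
HB.instance Definition _ := GRing.isZmodClosed.Build S idem_pred idem_zmod.

(** The type is indexed by the proof of idempotence because its ring structure, with unit [e],
    depends on it. *)
Record idem_loc (ee' : e * e = e) := IdemLoc {
  loc_val : S; loc_valP : loc_val \in idem_pred
}.
Local Notation L := (idem_loc ee).
HB.instance Definition _ := [isSub of L for @loc_val ee].
HB.instance Definition _ := [Choice of L by <:].
HB.instance Definition _ := [SubChoice_isSubZmodule of L by <:].

Lemma loc_valE (x : L) : e * loc_val x = loc_val x.
Proof. exact/eqP/loc_valP. Qed.

Fact loc_one_subproof : e \in idem_pred. Proof. exact/eqP. Qed.
Fact loc_mul_subproof (x y : L) : loc_val x * loc_val y \in idem_pred.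
Proof. by apply/eqP; rewrite mulrA loc_valE. Qed.
Definition loc_one : L := IdemLoc ee loc_one_subproof.
Definition loc_mul (x y : L) : L := IdemLoc ee (loc_mul_subproof x y).
Fact loc_mulA : associative loc_mul.
Proof. by move=> x y z; apply: val_inj; rewrite /= mulrA. Qed.
Fact loc_mulC : commutative loc_mul.
Proof. by move=> x y; apply: val_inj; rewrite /= mulrC. Qed.
Fact loc_mul1 : left_id loc_one loc_mul.
Proof. by move=> x; apply: val_inj; rewrite /= loc_valE. Qed.
Fact loc_mulDl : left_distributive loc_mul +%R.
Proof. by move=> x y z; apply: val_inj; rewrite /= mulrDl. Qed.
HB.instance Definition _ := GRing.Zmodule_isComPzRing.Build L
  loc_mulA loc_mulC loc_mul1 loc_mulDl.

Fact loc_proj_subproof x : e * x \in idem_pred.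
Proof. by apply/eqP; rewrite mulrA ee. Qed.
Definition loc_proj x : L := IdemLoc ee (loc_proj_subproof x).
Fact loc_proj_zmod : zmod_morphism loc_proj.
Proof. by move=> x y; apply: val_inj; rewrite /= mulrBr. Qed.
Fact loc_proj_monoid : monoid_morphism loc_proj.
Proof.
split=> [|x y]; apply: val_inj; rewrite /= ?mulr1 //.
by rewrite mulrACA ee.
Qed.
HB.instance Definition _ := GRing.isZmodMorphism.Build S L loc_proj loc_proj_zmod.
HB.instance Definition _ := GRing.isMonoidMorphism.Build S L loc_proj loc_proj_monoid.

Lemma loc_disc : exists n, forall a, maxpow A n a -> (loc_proj \o da_str S) a = 0.
Proof.
have [n Sn] := da_disc S; exists n => a /Sn /= ->; exact: rmorph0.
Qed.
Definition loc_dalg : dalg A := DAlg loc_disc.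
Definition loc_hom : dhom S loc_dalg := @DHom A S loc_dalg loc_proj (fun=> erefl).

Lemma loc_hom1 : loc_hom e = 1.
Proof. by apply: val_inj. Qed.

Section Lift.
Variables (S' : dalg A) (h : dhom S S').
Hypothesis he : h e = 1.
(** The equation [h e = 1] is an argument so that the morphism instance can be attached to this
    function: it is what makes the unit [e] go to 1. *)
Definition loc_lift_fun of h e = 1 := fun x : loc_dalg => h (loc_val (x : L)).
Fact loc_lift_zmod : zmod_morphism (loc_lift_fun he).
Proof. by move=> x y; rewrite /loc_lift_fun /= rmorphB. Qed.
Fact loc_lift_monoid : monoid_morphism (loc_lift_fun he).
Proof. by split=> // x y; rewrite /loc_lift_fun /= rmorphM. Qed.
HB.instance Definition _ :=
  GRing.isZmodMorphism.Build loc_dalg S' (loc_lift_fun he) loc_lift_zmod.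
HB.instance Definition _ :=
  GRing.isMonoidMorphism.Build loc_dalg S' (loc_lift_fun he) loc_lift_monoid.
Fact loc_lift_str a : loc_lift_fun he (da_str loc_dalg a) = da_str S' a.
Proof. by rewrite /loc_lift_fun /= rmorphM he mul1r dh_str. Qed.
Definition loc_lift : dhom loc_dalg S' := DHom loc_lift_str.
Lemma loc_liftE x : loc_lift (loc_hom x) = h x.
Proof. by rewrite /= /loc_lift_fun /= rmorphM he mul1r. Qed.
End Lift.
End IdemLoc.

(* h (u i) = 1 means that h factors through the localization at the idempotent
   u i, so that this is separatedness for the covers by open and closed subsets. *)
Definition separated (A : comUnitRingType) (X : group_functor A) : Prop :=
  forall (S : dalg A) (I : choiceType) (u : const_pts I S) (x y : X S),
    (forall i S' (h : dhom S S'), h (u i) = 1 -> pmap X h x = pmap X h y) -> x = y.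

Lemma dalg_separated (A : comUnitRingType) (S : dalg A) (I : choiceType)
    (u : const_pts I S) (x y : S) :
  (forall i S' (h : dhom S S'), h (u i) = 1 -> h x = h y) -> x = y.
Proof.
move=> xy; apply: (cval_separated (u := u)) => i.
by have /(congr1 val) := xy i _ (loc_hom (cval_idem u i)) (loc_hom1 _).
Qed.

(** * Evaluation of power series at nilpotent elements *)

Lemma sum_ord_trunc (V : nmodType) (m n : nat) (G : nat -> V) :
  (m <= n)%N -> (forall i, (m <= i)%N -> G i = 0) ->
  \sum_(i < n) G i = \sum_(i < m) G i.
Proof.
move=> mn G0; rewrite (big_ord_widen n G mn) [RHS]big_mkcond /=.
by apply: eq_bigr => i _; case: ltnP => // /G0.
Qed.

Lemma fcoefM (A : comNzRingType) (f g : fps A) n :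
  fcoef (f * g) n = \sum_(i < n.+1) fcoef f i * fcoef g (n - i).
Proof. by []. Qed.

Lemma fcoefD (A : comNzRingType) (f g : fps A) n :
  fcoef (f + g) n = fcoef f n + fcoef g n.
Proof. by []. Qed.

Lemma fcoef_sum (A : comNzRingType) (I : Type) (r : seq I) (P : pred I) (G : I -> fps A) n :
  fcoef (\sum_(i <- r | P i) G i) n = \sum_(i <- r | P i) fcoef (G i) n.
Proof. by elim/big_ind2: _ => // f x g y <- <-. Qed.

Lemma fcoefCM (A : comNzRingType) (a : A) (f : fps A) n :
  fcoef (fpsC a * f) n = a * fcoef f n.
Proof.
rewrite fcoefM big_ord_recl subn0 big1 ?addr0 // => i _.
by rewrite /= mul0r.
Qed.

Lemma fcoefXM (A : comNzRingType) (f : fps A) n :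
  fcoef (fpsX A * f) n = if n is m.+1 then fcoef f m else 0.
Proof.
rewrite fcoefM big_ord_recl /= mul0r add0r; case: n => [|n]; first by rewrite big_ord0.
rewrite big_ord_recl /= mul1r subn1 big1 ?addr0 // => i _.
by rewrite mul0r.
Qed.

Lemma fcoefXnM (A : comNzRingType) (f : fps A) i n :
  fcoef (fpsX A ^+ i * f) n = if (i <= n)%N then fcoef f (n - i) else 0.
Proof.
elim: i n => [|i IH] n; first by rewrite expr0 mul1r subn0.
by rewrite exprS -mulrA fcoefXM; case: n => // n; rewrite IH.
Qed.

Section PowerCoef.
Variable A : comNzRingType.
Implicit Types f g : fps A.

Lemma fcoef_exp_small f j n : fcoef f 0 = 0 -> (n < j)%N -> fcoef (f ^+ j) n = 0.
Proof.
move=> f0; elim: j n => // j IH n nj; rewrite exprS fcoefM big1 // => -[[|i] /= lei] _.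
  by rewrite f0 mul0r.
rewrite IH ?mulr0 //; case: n lei nj => // n _.
by rewrite ltnS subSS; apply: leq_ltn_trans (leq_subr _ _).
Qed.

Lemma fcoef_exp_local f g j n : (forall m, (m <= n)%N -> fcoef f m = fcoef g m) ->
  fcoef (f ^+ j) n = fcoef (g ^+ j) n.
Proof.
elim: j n => // j IH n fg; rewrite !exprS !fcoefM; apply: eq_bigr => -[i /= lei] _.
rewrite fg //; congr (_ * _); apply: IH => m mi.
exact/fg/(leq_trans mi)/leq_subr.
Qed.

(** In a product of at least two series without constant term, the coefficient of index [n] of one
    factor only meets the zero constant term of the rest. *)
Lemma fcoef_exp_local0 f g j n : fcoef f 0 = 0 -> fcoef g 0 = 0 ->
  (forall m, (m < n)%N -> fcoef f m = fcoef g m) -> j != 1%N ->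
  fcoef (f ^+ j) n = fcoef (g ^+ j) n.
Proof.
case: j => // -[//|j] f0 g0 fg _; rewrite !(exprS _ j.+1) !fcoefM.
apply: eq_bigr => -[i /=]; rewrite ltnS leq_eqVlt => /orP[/eqP-> _|lein _].
  by rewrite subnn !fcoef_exp_small ?mulr0.
case: i lein => [|i] lein; first by rewrite f0 g0 !mul0r.
rewrite fg //; congr (_ * _); apply: fcoef_exp_local => m mi; apply: fg.
by apply: leq_ltn_trans mi _; rewrite ltn_subrL (leq_trans _ lein).
Qed.

(** [Phi] is a contraction for the adic topology: in the iterates from 0, the coefficient of index
    [n] is settled after [n.+1] steps. *)
Lemma fps_fixpoint (Phi : fps A -> fps A) :
  (forall f g n, (forall m, (m < n)%N -> fcoef f m = fcoef g m) ->
     fcoef (Phi f) n = fcoef (Phi g) n) ->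
  exists f, Phi f = f.
Proof.
move=> loc; pose u n := iter n Phi 0.
have uS k n : (n < k)%N -> fcoef (u k) n = fcoef (u k.+1) n.
  elim: k n => // k IH n nk; apply: loc => m mn; apply: IH.
  exact: leq_trans mn _.
have uE k n : (n < k)%N -> fcoef (u k) n = fcoef (u n.+1) n.
  elim: k => // k IH; rewrite ltnS leq_eqVlt => /orP[/eqP-> //|nk].
  by rewrite -uS // IH.
exists (FPS (fun n => fcoef (u n.+1) n)); apply: fpsP => n /=.
by apply: loc => m mn /=; rewrite -(uE n).
Qed.
End PowerCoef.

(** Some exponent that kills [x], not necessarily the least. Truncating series there is harmless, as
    [fps_evalE] allows any other such exponent. *)
Definition nilp_order (S : comPzRingType) (x : nilp S) : nat := sval (cid (nvalP x)).

Lemma nilp_orderP (S : comPzRingType) (x : nilp S) n :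
  (nilp_order x <= n)%N -> nval x ^+ n = 0.
Proof.
rewrite /nilp_order; case: cid => m /= xm mn.
by rewrite -(subnK mn) exprD xm mulr0.
Qed.

Lemma nilp_inj (S : comPzRingType) (x y : nilp S) : nval x = nval y -> x = y.
Proof.
by case: x y => x xP [y yP] /= xy; case: y / xy yP => yP; congr Nilp; apply: Prop_irrelevance.
Qed.

Section FpsEval.
Variables (A : comNzRingType) (S : comPzRingType) (phi : {rmorphism A -> S}) (x : nilp S).

Definition fps_eval (f : fps A) : S :=
  \sum_(i < nilp_order x) phi (fcoef f i) * nval x ^+ i.

Lemma fps_evalE n f : nval x ^+ n = 0 ->
  fps_eval f = \sum_(i < n) phi (fcoef f i) * nval x ^+ i.
Proof.
move=> xn; pose G i := phi (fcoef f i) * nval x ^+ i.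
have G0 m : nval x ^+ m = 0 -> forall i, (m <= i)%N -> G i = 0.
  by move=> xm i /subnK <-; rewrite /G exprD xm !mulr0.
have o0 := nilp_orderP (leqnn (nilp_order x)).
rewrite -[RHS](sum_ord_trunc (G := G) (leq_addr (nilp_order x) n)); last exact: G0.
by rewrite [RHS](sum_ord_trunc (G := G) (leq_addl n (nilp_order x))) //; exact: G0.
Qed.

Fact fps_eval_zmod : zmod_morphism fps_eval.
Proof.
by move=> f g; rewrite /fps_eval -sumrB; apply: eq_bigr => i _; rewrite -mulrBl -rmorphB.
Qed.

Lemma fps_evalC a : fps_eval (fpsC a) = phi a.
Proof.
rewrite (@fps_evalE (nilp_order x).+1) ?nilp_orderP // big_ord_recl mulr1 big1 ?addr0 // => i _.
by rewrite rmorph0 mul0r.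
Qed.

Lemma fps_evalX : fps_eval (fpsX A) = nval x.
Proof.
have X0 i : i != 1%N -> fcoef (fpsX A) i = 0 by move=> /negPf /= ->.
rewrite (@fps_evalE (nilp_order x).+2) ?nilp_orderP 1?ltnW // !big_ord_recl.
rewrite big1 => [|i _]; last by rewrite X0 ?rmorph0 ?mul0r.
have -> : fcoef (fpsX A) (lift ord0 (@ord0 (nilp_order x))) = 1 by [].
by rewrite X0 // rmorph0 rmorph1 mul0r mul1r add0r addr0.
Qed.

Fact fps_eval_monoid : monoid_morphism fps_eval.
Proof.
split=> [|f g]; first by rewrite fps_evalC rmorph1.
set n := nilp_order x; have xn : nval x ^+ n = 0 by apply: nilp_orderP.
pose a i := phi (fcoef f i); pose b i := phi (fcoef g i).
transitivity (\sum_(i < n) \sum_(k < n | (i <= k)%N) a i * b (k - i)%N * nval x ^+ k).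
  rewrite (exchange_big_dep xpredT) //=; apply: eq_bigr => k _.
  rewrite fcoefM rmorph_sum big_distrl /=.
  rewrite (big_ord_widen n (fun i => phi (fcoef f i * fcoef g (k - i)) * nval x ^+ k)) //=.
  by apply: eq_bigr => i _; rewrite rmorphM.
rewrite big_distrl /=; apply: eq_bigr => i _.
rewrite -(big_geq_mkord i n xpredT (fun k => a i * b (k - i)%N * nval x ^+ k)).
rewrite -{1}[nat_of_ord i]add0n big_addn big_mkord.
(* Here [j] stands for [k - i]. Extending its range from [n - i] to [n] only adds terms in which the
   exponent of the variable is at least [n]. *)
transitivity (\sum_(j < n) a i * b j * nval x ^+ (j + i)).
  rewrite [RHS](sum_ord_trunc (m := (n - i)%N) (G := fun j => a i * b j * nval x ^+ (j + i))).
  - by apply: eq_bigr => j _; rewrite addnK.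
  - exact: leq_subr.
  - move=> j; rewrite leq_subLR addnC => /subnK <-.
    by rewrite exprD xn !mulr0.
rewrite big_distrr; apply: eq_bigr => j _ /=.
by rewrite addnC exprD mulrACA.
Qed.

HB.instance Definition _ := GRing.isZmodMorphism.Build (fps A) S fps_eval fps_eval_zmod.
HB.instance Definition _ := GRing.isMonoidMorphism.Build (fps A) S fps_eval fps_eval_monoid.
End FpsEval.


(** * The group of points of a formal group law *)

Section FormalGroupLaw.
Variables (E : comUnitRingType) (F : fgl E).

Lemma fgl_exp_small i a b : (a + b < i)%N -> fcoef (fcoef (fgl_ser F ^+ i) a) b = 0.
Proof.
elim: i a b => // i IH a b abi; rewrite exprS (@fcoefM (fps E)) fcoef_sum big1 // => -[a' /= la] _.
rewrite big1 // => -[b' /= lb] _.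
have [/eqP|ab0] := posnP (a' + b').
  rewrite addn_eq0 => /andP[/eqP-> /eqP->].
  by rewrite -[fcoef (fcoef _ _) _]/(fgl_coef F 0 0) fgl_unit mul0r.
by rewrite IH ?mulr0 //; lia.
Qed.

(** The bounds of the axiom depend on the monomial; a common bound allows all monomials to be summed
    at once. *)
Lemma fgl_assoc_trunc N a b d : (a + b < N)%N -> (b + d < N)%N ->
  \sum_(i < N) fgl_coef F i d * fcoef (fcoef (fgl_ser F ^+ i) a) b =
  \sum_(j < N) fgl_coef F a j * fcoef (fcoef (fgl_ser F ^+ j) b) d.
Proof.
move=> abN bdN.
rewrite (sum_ord_trunc (G := fun i => fgl_coef F i d * fcoef (fcoef (fgl_ser F ^+ i) a) b) abN).
  rewrite [RHS](sum_ord_trunc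
    (G := fun j => fgl_coef F a j * fcoef (fcoef (fgl_ser F ^+ j) b) d) bdN).
    exact: fgl_assoc.
  by move=> i li; rewrite fgl_exp_small ?mulr0.
by move=> i li; rewrite fgl_exp_small ?mulr0.
Qed.

(* The coefficient of X^n in F(X, f(X)). *)
Let fgl_subst (f : fps E) n :=
  \sum_(i < n.+1) \sum_(j < n.+1) fgl_coef F i j * fcoef (f ^+ j) (n - i).

(** As $F(x, y) = x + y + xy(\ldots)$, the last coefficient of $f$ enters that of $F(X, f)$ only
    through the linear term $y$. *)
Lemma fgl_subst_local f g n : fcoef f 0 = 0 -> fcoef g 0 = 0 ->
  (forall m, (m < n.+1)%N -> fcoef f m = fcoef g m) ->
  fgl_subst f n.+1 - fgl_subst g n.+1 = fcoef f n.+1 - fcoef g n.+1.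
Proof.
move=> f0 g0 fg; rewrite -sumrB big_ord_recl [X in _ + X]big1 ?addr0 => [|i _]; last first.
  rewrite -sumrB big1 // => j _; rewrite (@fcoef_exp_local _ f g) ?subrr // => m.
  by rewrite lift0 subSS => mn; apply: fg; rewrite ltnS (leq_trans mn) ?leq_subr.
rewrite -sumrB !big_ord_recl big1 ?addr0 => [|j _]; last first.
  have e := fcoef_exp_local0 f0 g0 fg (isT : j.+2 != 1%N).
  by rewrite !lift0 subn0 e subrr.
by rewrite lift0 !subn0 !expr0 !expr1 subrr add0r fgl_comm fgl_unit !mul1r.
Qed.

(** The set from which [xget] chooses is not empty: the inverse series is found as a fixed point. *)
Lemma fgl_oppP : fcoef (fgl_opp F) 0 = 0 /\ forall n, fgl_subst (fgl_opp F) n = 0.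
Proof.
rewrite /fgl_opp; case: xgetP => [f _ //|].
(* [Z] resets the constant term, so that the map [Phi] below is local on all series. A fixed point
   of [Phi] has zero constant term and all coefficients of $F(X, f)$ vanish. *)
pose Z (f : fps E) : fps E := FPS (fun n => if n is 0%N then 0 else fcoef f n).
pose Phi (f : fps E) : fps E :=
  FPS (fun n => if n is m.+1 then fcoef f n - fgl_subst (Z f) n else 0).
have [|f fP] := @fps_fixpoint _ Phi.
  move=> f g [|n] fg; first by rewrite /Phi.
  apply/eqP; rewrite /= subr_eq addrAC -[_ + _ - _]addrA fgl_subst_local //.
    by rewrite [X in _ == X]addrC subrK.
  by case=> //= m mn; apply: fg.
have Zf : Z f = f by apply: fpsP => -[|n] //=; rewrite -fP.
move=> /(_ f); case; split=> [|n]; first by rewrite -fP.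
case: n => [|n]; first by rewrite !big_ord1 fgl_unit mul0r.
have /eqP := congr1 (fun h => fcoef h n.+1) fP.
by rewrite /= Zf -subr_eq0 addrC addKr oppr_eq0 => /eqP.
Qed.
End FormalGroupLaw.

Section NilpPoints.
Variables (E : comUnitRingType) (F : fgl E).
Variable S : dalg E.
Implicit Types x y z : nilp S.
Local Notation c i j := (da_str S (fgl_coef F i j)).

Lemma nilp_addE x y n m : nval x ^+ n = 0 -> nval y ^+ m = 0 ->
  nilp_add_val F x y = \sum_(i < n) \sum_(j < m) c i j * nval x ^+ i * nval y ^+ j.
Proof.
move=> xn ym; pose G i j := c i j * nval x ^+ i * nval y ^+ j.
rewrite /nilp_add_val (@fsumE _ _ [seq (i, j) | i <- iota 0 n, j <- iota 0 m]).
- under eq_bigl do rewrite in_setT.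
  rewrite big_allpairs /= -[X in iota 0 X]subn0 big_mkord; apply: eq_bigr => i _.
  by rewrite -[X in iota 0 X]subn0 big_mkord.
- by apply: allpairs_uniq; rewrite ?iota_uniq // => -[? ?] [? ?].
- move=> [i j] /=; apply: contraNT => ij; apply/eqP.
  have [ni|ni] := leqP n i; first by rewrite -(subnK ni) exprD xn !mulr0 mul0r.
  have [mj|mj] := leqP m j; first by rewrite -(subnK mj) exprD ym !mulr0.
  by case/negP: ij; apply/allpairsP; exists (i, j); rewrite !mem_iota !add0n.
Qed.

(** Two nested evaluations, first of the coefficients at [y], then of the series at [x]. Both are
    ring morphisms, which gives the powers of the sum from the coefficients of the powers of [F]. *)
Lemma nilp_addEeval x y :
  nilp_add_val F x y = fps_eval (fps_eval (da_str S) y) x (fgl_ser F).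
Proof.
rewrite (@nilp_addE x y (nilp_order x) (nilp_order y)) ?nilp_orderP //.
apply: eq_bigr => i _; rewrite big_distrl; apply: eq_bigr => j _ /=.
by rewrite mulrAC.
Qed.

Lemma nilp_add_exp x y n m i : nval x ^+ n = 0 -> nval y ^+ m = 0 ->
  nilp_add_val F x y ^+ i = \sum_(a < n) \sum_(b < m)
    da_str S (fcoef (fcoef (fgl_ser F ^+ i) a) b) * nval x ^+ a * nval y ^+ b.
Proof.
move=> xn ym; rewrite nilp_addEeval -rmorphXn /= (fps_evalE _ _ xn).
apply: eq_bigr => a _; rewrite /= (fps_evalE _ _ ym) big_distrl; apply: eq_bigr => b _.
by rewrite /= mulrAC.
Qed.

Lemma nilp_oppE x : nilp_opp_val F x = fps_eval (da_str S) x (fgl_opp F).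
Proof.
rewrite /nilp_opp_val (@fsumE _ _ (iota 0 (nilp_order x))) ?iota_uniq //.
  under eq_bigl do rewrite in_setT.
  by rewrite -[X in iota 0 X]subn0 big_mkord.
move=> i; rewrite mem_iota add0n /=; apply: contraNT; rewrite -leqNgt => /nilp_orderP ->.
by rewrite mulr0.
Qed.

Lemma nilp_addC : commutative (@nilp_add E F S).
Proof.
move=> x y; apply: nilp_inj => /=.
pose n := nilp_order x; pose m := nilp_order y.
rewrite (@nilp_addE x y n m) ?nilp_orderP // (@nilp_addE y x m n) ?nilp_orderP //.
rewrite exchange_big; apply: eq_bigr => j _; apply: eq_bigr => i _.
by rewrite fgl_comm mulrAC.
Qed.

(** The axioms $F(x, 0) = x$ and $F(0, y) = y$ leave only mixed monomials besides $x + y$. *)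
Lemma nilp_add_quad x y :
  exists t, nval (nilp_add F x y) = nval x + nval y + nval x * nval y * t.
Proof.
pose n := (nilp_order x).+1; pose m := (nilp_order y).+1.
exists (\sum_(i < n) \sum_(j < m) c i.+1 j.+1 * nval x ^+ i * nval y ^+ j).
have c0 j : fgl_coef F 0 j = (j == 1%N)%:R by rewrite fgl_comm fgl_unit.
rewrite /= (@nilp_addE x y n.+1 m.+1) ?nilp_orderP ?leqW // big_ord_recl.
have -> : \sum_(j < m.+1) c (@ord0 n) j * nval x ^+ (@ord0 n) * nval y ^+ j = nval y.
  rewrite !big_ord_recl big1 => [|j _].
    by rewrite !c0 rmorph0 rmorph1 !mul0r !mul1r add0r addr0.
  by rewrite c0 rmorph0 !mul0r.
have row (i : 'I_n) : \sum_(j < m.+1) c (lift ord0 i) j * nval x ^+ (lift ord0 i) * nval y ^+ j =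
    (i == 0%N :> nat)%:R * nval x +
    nval x * nval y * \sum_(j < m) c i.+1 j.+1 * nval x ^+ i * nval y ^+ j.
  rewrite big_ord_recl lift0 fgl_unit mulr1; congr (_ + _).
    by case: (nat_of_ord i) => [|i']; rewrite ?rmorph1 ?rmorph0 ?mul0r.
  rewrite big_distrr; apply: eq_bigr => j _.
  by rewrite lift0 !exprS /= [RHS]mulrACA [X in _ = X * _]mulrCA.
rewrite (eq_bigr _ (fun i _ => row i)) big_split -big_distrr -big_distrl /=.
rewrite big_ord_recl big1 => [|i _]; last by rewrite lift0.
by rewrite addr0 mul1r addrA [nval y + _]addrC.
Qed.

Lemma nilp_add0 : left_id (nilp0 S) (@nilp_add E F S).
Proof.
move=> x; apply: nilp_inj; have [t ->] := nilp_add_quad (nilp0 S) x.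
by rewrite /= !mul0r addr0 add0r.
Qed.

Lemma nilp_addA : associative (@nilp_add E F S).
Proof.
move=> x y z; apply: nilp_inj.
pose M := (nilp_order x + nilp_order y + nilp_order z)%N.
have xM : nval x ^+ M = 0 by apply: nilp_orderP; rewrite /M -addnA leq_addr.
have yM : nval y ^+ M = 0 by apply: nilp_orderP; rewrite /M addnAC leq_addl.
have zM : nval z ^+ M = 0 by apply: nilp_orderP; rewrite /M leq_addl.
set v := nilp_add F y z; set w := nilp_add F x y.
(* [M] kills the three points and [N] the two inner sums; [N] is at least [M + M] so that it also
   bounds the total degrees in [fgl_assoc_trunc]. *)
pose N := (M + M + nilp_order v + nilp_order w)%N.
have vN : nval v ^+ N = 0 by apply: nilp_orderP; rewrite /N addnAC leq_addl.
have wN : nval w ^+ N = 0 by apply: nilp_orderP; rewrite /N leq_addl.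
have MN : (M + M <= N)%N by rewrite /N -addnA leq_addr.
have lt2 (i j : 'I_M) : (i + j < N)%N.
  by apply: leq_trans MN; rewrite -addnS leq_add // ltnW.
rewrite /= (nilp_addE xM vN) (nilp_addE wN zM).
pose G a b d (e : E) := da_str S e * nval x ^+ a * nval y ^+ b * nval z ^+ d.
transitivity (\sum_(a < M) \sum_(b < M) \sum_(d < M)
    G a b d (\sum_(j < N) fgl_coef F a j * fcoef (fcoef (fgl_ser F ^+ j) b) d)).
  apply: eq_bigr => a _.
  under eq_bigr => j _.
    rewrite (nilp_add_exp _ yM zM) big_distrr.
    under eq_bigr => b _ do rewrite big_distrr.
    over.
  rewrite exchange_big; apply: eq_bigr => b _.
  rewrite exchange_big; apply: eq_bigr => d _.
  rewrite /G rmorph_sum !big_distrl; apply: eq_bigr => j _ /=.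
  by rewrite rmorphM !mulrA; congr (_ * _ * _); rewrite mulrAC.
under eq_bigr => a _ do under eq_bigr => b _ do under eq_bigr => d _ do
  rewrite -(@fgl_assoc_trunc _ _ N) ?lt2 //.
symmetry.
under [LHS]eq_bigr => i _.
  under eq_bigr => d _.
    rewrite (nilp_add_exp _ xM yM) big_distrr big_distrl.
    under eq_bigr => a _ do rewrite big_distrr big_distrl.
    over.
  rewrite exchange_big.
  under eq_bigr => a _ do rewrite exchange_big.
  over.
rewrite exchange_big; apply: eq_bigr => a _.
rewrite exchange_big; apply: eq_bigr => b _.
rewrite exchange_big; apply: eq_bigr => d _.
rewrite /G rmorph_sum !big_distrl; apply: eq_bigr => j _ /=.
by rewrite rmorphM !mulrA.
Qed.

Lemma nilp_addN : left_inverse (nilp0 S) (@nilp_opp E F S) (@nilp_add E F S).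
Proof.
move=> x; rewrite nilp_addC; apply: nilp_inj => /=.
pose M := nilp_order x; have xM : nval x ^+ M = 0 by apply: nilp_orderP.
pose N := (M + nilp_order (nilp_opp F x))%N.
have oN : nval (nilp_opp F x) ^+ N = 0 by apply: nilp_orderP; rewrite leq_addl.
rewrite (nilp_addE xM oN) /= nilp_oppE.
(* A truncation of $F(X, -_F X)$. As [M] kills [x], only coefficients of index below [M] count, and
   as [N] is at least [M] they are those of the full composite, hence zero. *)
pose H := \sum_(i < M) \sum_(j < N) fpsC (fgl_coef F i j) * (fpsX E ^+ i * fgl_opp F ^+ j).
transitivity (fps_eval (da_str S) x H).
  rewrite rmorph_sum; apply: eq_bigr => i _; rewrite rmorph_sum; apply: eq_bigr => j _ /=.
  by rewrite rmorphM /= fps_evalC rmorphM /= !rmorphXn /= fps_evalX mulrA.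
rewrite (fps_evalE _ _ xM) big1 // => -[n /= nM] _.
suff -> : fcoef H n = 0 by rewrite rmorph0 mul0r.
have [o0 oP] := fgl_oppP F; rewrite -[RHS](oP n) fcoef_sum.
pose K i j := fgl_coef F i j * (if (i <= n)%N then fcoef (fgl_opp F ^+ j) (n - i) else 0).
rewrite (eq_bigr (fun i : 'I_M => \sum_(j < N) K i j)) => [|i _]; last first.
  by rewrite fcoef_sum; apply: eq_bigr => j _; rewrite fcoefCM fcoefXnM.
rewrite (sum_ord_trunc (G := fun i => \sum_(j < N) K i j) nM) => [|i ni]; last first.
  by rewrite big1 // => j _; rewrite /K leqNgt ni mulr0.
apply: eq_bigr => -[i /=]; rewrite ltnS => lein _.
have nN : (n < N)%N by rewrite (leq_trans nM) ?leq_addr.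
rewrite (sum_ord_trunc (G := K i) nN) => [|j nj]; last first.
  rewrite /K lein fcoef_exp_small ?mulr0 //; apply: leq_ltn_trans nj; exact: leq_subr.
by apply: eq_bigr => j _; rewrite /K lein.
Qed.
End NilpPoints.

(** * Group functors *)

Section GroupLaws.
Variables (A : comUnitRingType) (X : group_functor A).

(* The conditions of is_formal_group_scheme other than is_formal_scheme. *)
Definition group_laws : Prop :=
  [/\ is_functor X,
      (forall S S' (f : dhom S S'), pmap X f (pzero X S) = pzero X S') /\
      (forall S S' (f : dhom S S') (a b : X S),
         pmap X f (padd X a b) = padd X (pmap X f a) (pmap X f b)) &
      forall S, [/\ associative (@padd A X S), commutative (@padd A X S),
                    left_id (pzero X S) (@padd A X S) &
                    forall a : X S, exists b, padd X b a = pzero X S]].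

Lemma formal_group_laws_of_scheme : is_formal_group_scheme X -> group_laws.
Proof. by case. Qed.

Section GroupOfPoints.
Variables (H : group_laws) (S : dalg A).

(* An alias of X S that carries the zmodType structure given by H. *)
Definition gpt (_ : group_laws) (S : dalg A) : Type := X S.
Local Notation V := (gpt H S).

Fact gpt_addA : associative (@padd A X S : V -> V -> V). Proof. by have [_ _ /(_ S)[]] := H. Qed.
Fact gpt_addC : commutative (@padd A X S : V -> V -> V). Proof. by have [_ _ /(_ S)[]] := H. Qed.
Fact gpt_add0 : left_id (pzero X S : V) (@padd A X S : V -> V -> V).
Proof. by have [_ _ /(_ S)[]] := H. Qed.
Fact gpt_addN_ex (a : V) : exists b : V, padd X b a = pzero X S.
Proof. by have [_ _ /(_ S)[_ _ _]] := H; apply. Qed.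
Definition gpt_opp (a : V) : V := sval (cid (gpt_addN_ex a)).
Fact gpt_addN : left_inverse (pzero X S : V) gpt_opp (@padd A X S : V -> V -> V).
Proof. by move=> a; exact: svalP (cid (gpt_addN_ex a)). Qed.

HB.instance Definition _ := gen_eqMixin V.
HB.instance Definition _ := gen_choiceMixin V.
HB.instance Definition _ := GRing.isZmodule.Build V gpt_addA gpt_addC gpt_add0 gpt_addN.
End GroupOfPoints.
End GroupLaws.

Lemma base_change_laws (A B : comUnitRingType) (f : cmor A B) (X : group_functor A) :
  group_laws X -> group_laws (base_change f X).
Proof.
case=> [[X1 XM] [X0 XD] XG]; split.
- split=> [S h hid a|S S' S'' g h l hgl a]; first exact: X1.
  exact: XM.
- split=> [S S' h|S S' h a b]; [exact: X0 | exact: XD].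
- by move=> S; exact: XG.
Qed.

Section FiberProductLaws.
Variables (A : comUnitRingType) (X Y Z : group_functor A).
Variables (f : forall S, X S -> Z S) (g : forall S, Y S -> Z S).
Hypotheses (fP : is_hom f) (gP : is_hom g).
Local Notation P := (fiber_product fP gP).

Lemma fib_ext S (x y : P S) : fib1 x = fib1 y -> fib2 x = fib2 y -> x = y.
Proof.
case: x y => x1 x2 xP [y1 y2 yP] /= e1 e2.
by case: y1 / e1 yP; case: y2 / e2 => yP; congr FibPts; apply: Prop_irrelevance.
Qed.

Lemma fiber_product_laws : group_laws X -> group_laws Y -> group_laws Z -> group_laws P.
Proof.
move=> [[X1 XM] [X0 XD] XG] [[Y1 YM] [Y0 YD] YG] [_ _ ZG].
have [[_ f0 fD] [_ g0 gD]] := (fP, gP).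
split.
- split=> [S h hid a|S S' S'' u v w wuv a]; apply: fib_ext => /=.
  + exact: X1.
  + exact: Y1.
  + exact: XM.
  + exact: YM.
- by split=> [S S' h|S S' h a b]; apply: fib_ext => /=.
- move=> S; have [XA XC Xz XN] := XG S; have [YA YC Yz YN] := YG S.
  have [ZA ZC Zz ZN] := ZG S; split=> [a b c|a b|a|a].
  1-3: by apply: fib_ext => /=.
  have [x xN] := XN (fib1 a); have [y yN] := YN (fib2 a).
  (* The negatives of the two components lie over the same point, because negatives in [Z] are
     unique. *)
  have xy : f x = g y.
    have [z zN] := ZN (f (fib1 a)).
    rewrite -[f x]Zz -[g y]Zz -zN -!ZA ![padd Z (f (fib1 a)) _]ZC.
    by rewrite -fD fibP -gD xN yN f0 g0.
  by exists (FibPts xy); apply: fib_ext.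
Qed.
End FiberProductLaws.

Section ConstLaws.
Variable S : comPzRingType.

Lemma const_tens_delta (I J : choiceType) (i : I) (j : J) :
  const_tens (const_delta S i) (const_delta S j) = const_delta S (i, j).
Proof. by apply: cval_eq1; rewrite /= !eqxx mulr1. Qed.

Lemma const_add_delta (A : zmodType) (a b : A) :
  const_add (const_delta S a) (const_delta S b) = const_delta S (a + b).
Proof. by rewrite /const_add const_tens_delta const_push_delta. Qed.

Lemma const_map_eq1 (S' : comPzRingType) (h : {rmorphism S -> S'}) (I : choiceType)
    (e : const_pts I S) i : h (e i) = 1 -> const_map h e = const_delta S' i.
Proof. by move=> hi; apply: cval_eq1. Qed.

Lemma const_map_tens (S' : comPzRingType) (h : {rmorphism S -> S'}) (I J : choiceType)
    (e : const_pts I S) (f : const_pts J S) :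
  const_map h (const_tens e f) = const_tens (const_map h e) (const_map h f).
Proof. by apply: const_ptsP => ij; rewrite /= rmorphM. Qed.

Lemma const_map_add (S' : comPzRingType) (h : {rmorphism S -> S'}) (A : zmodType)
    (e f : const_pts A S) :
  const_map h (const_add e f) = const_add (const_map h e) (const_map h f).
Proof. by rewrite /const_add -const_push_map const_map_tens. Qed.

Lemma const_map_delta (S' : comPzRingType) (h : {rmorphism S -> S'}) (I : choiceType) (i : I) :
  const_map h (const_delta S i) = const_delta S' i.
Proof. by apply: const_map_eq1; rewrite /= eqxx rmorph1. Qed.
End ConstLaws.

Section Separated.
Variables (A : comUnitRingType) (X : group_functor A).
Hypothesis Xsep : separated X.

(** Identities between points reduce in this way to loci where the point of the constant scheme is a
    single element, so that group laws can be computed on [const_delta]. *)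
Lemma separated1 (S : dalg A) (I : choiceType) (e : const_pts I S) (x y : X S) :
  (forall i S' (h : dhom S S'), const_map h e = const_delta S' i ->
     pmap X h x = pmap X h y) -> x = y.
Proof.
move=> xy; apply: (Xsep (u := e)) => i S' h hi; apply: (xy i); exact: const_map_eq1.
Qed.

Lemma separated2 (S : dalg A) (I J : choiceType) (e : const_pts I S) (f : const_pts J S)
    (x y : X S) :
  (forall i j S' (h : dhom S S'), const_map h e = const_delta S' i ->
     const_map h f = const_delta S' j -> pmap X h x = pmap X h y) -> x = y.
Proof.
move=> xy; apply: (separated1 (e := const_tens e f)) => -[i j] S' h.
rewrite const_map_tens => ef.
have [|ei fj] := @const_tens_eq1 _ _ _ (const_map h e) (const_map h f) i j.
  by rewrite ef /= eqxx.
exact: (xy i j).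
Qed.

Lemma separated3 (S : dalg A) (I J L : choiceType) (e : const_pts I S) (f : const_pts J S)
    (g : const_pts L S) (x y : X S) :
  (forall i j l S' (h : dhom S S'), const_map h e = const_delta S' i ->
     const_map h f = const_delta S' j -> const_map h g = const_delta S' l ->
     pmap X h x = pmap X h y) -> x = y.
Proof.
move=> xy; apply: (separated2 (e := e) (f := const_tens f g)) => i [j l] S' h ei.
rewrite const_map_tens => fg.
have [|fj gl] := @const_tens_eq1 _ _ _ (const_map h f) (const_map h g) j l.
  by rewrite fg /= eqxx.
exact: (xy i j l).
Qed.
End Separated.

Section ConstGroup.
Variables (K : comUnitRingType) (A : zmodType).

Lemma const_gs_separated : separated (const_gs K A).
Proof.
move=> S I u e f ef; apply: const_ptsP => a.
apply: (dalg_separated (u := u)) => i S' h hi.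
exact: (congr1 (fun e' : const_pts A S' => cval e' a) (ef i S' h hi)).
Qed.

Lemma const_gs_laws : group_laws (const_gs K A).
Proof.
have sep := const_gs_separated.
split.
- split=> [S h hid e|S S' S'' g h l hgl e]; apply: const_ptsP => a /=.
    exact: hid.
  exact: hgl.
- split=> [S S' h|S S' h e f]; [exact: const_map_delta | exact: const_map_add].
- move=> S; split.
  + move=> e f g; apply: (separated3 sep (e := e) (f := f) (g := g)) => a b c S' h ea fb gc.
    by rewrite /= !const_map_add ea fb gc !const_add_delta addrA.
  + move=> e f; apply: (separated2 sep (e := e) (f := f)) => a b S' h ea fb.
    by rewrite /= !const_map_add ea fb !const_add_delta addrC.
  + move=> e; apply: (separated1 sep (e := e)) => a S' h ea.
    by rewrite /= const_map_add const_map_delta ea const_add_delta add0r.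
  + move=> e; exists (const_push -%R e); apply: (separated1 sep (e := e)) => a S' h ea.
    rewrite /= const_map_add const_map_delta -const_push_map ea const_push_delta.
    by rewrite const_add_delta addNr.
Qed.
End ConstGroup.

Section FormalGroupLaws.
Variables (E : comUnitRingType) (F : fgl E).

Lemma nilp_map_add (S S' : dalg E) (h : dhom S S') (x y : nilp S) :
  nilp_map h (nilp_add F x y) = nilp_add F (nilp_map h x) (nilp_map h y).
Proof.
apply: nilp_inj => /=; have xn := nilp_orderP (leqnn (nilp_order x)).
have ym := nilp_orderP (leqnn (nilp_order y)).
have hxn : nval (nilp_map h x) ^+ nilp_order x = 0 by rewrite /= -rmorphXn xn rmorph0.
have hym : nval (nilp_map h y) ^+ nilp_order y = 0 by rewrite /= -rmorphXn ym rmorph0.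
rewrite (nilp_addE F xn ym) (nilp_addE F hxn hym) rmorph_sum; apply: eq_bigr => i _.
by rewrite rmorph_sum; apply: eq_bigr => j _; rewrite !rmorphM !rmorphXn /= dh_str.
Qed.

Lemma formal_group_laws : group_laws (formal_group F).
Proof.
split.
- split=> [S h hid e|S S' S'' g h l hgl e]; apply: nilp_inj => /=.
    exact: hid.
  exact: hgl.
- split=> [S S' h|S S' h x y]; last exact: nilp_map_add.
  by apply: nilp_inj; rewrite /= rmorph0.
- move=> S; split; [exact: nilp_addA | exact: nilp_addC | exact: nilp_add0 |].
  by move=> x; exists (nilp_opp F x); apply: nilp_addN.
Qed.

Lemma nilp_oppP (S : dalg E) (x : gpt formal_group_laws S) :
  nilp_opp F x = - x :> gpt formal_group_laws S.
Proof. by apply/eqP; rewrite -addr_eq0; apply/eqP; exact: nilp_addN. Qed.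

Lemma nilp_map_opp (S S' : dalg E) (h : dhom S S') (x : nilp S) :
  nilp_map h (nilp_opp F x) = nilp_opp F (nilp_map h x).
Proof.
apply: (@addIr (gpt formal_group_laws S') (nilp_map h x)).
change (nilp_add F (nilp_map h (nilp_opp F x)) (nilp_map h x) =
  nilp_add F (nilp_opp F (nilp_map h x)) (nilp_map h x)).
by rewrite -nilp_map_add !nilp_addN; apply: nilp_inj; rewrite /= rmorph0.
Qed.
End FormalGroupLaws.

(** * The Tate group *)

Section QZCarry.
Implicit Types a b c : QZ.

(** The 2-cocycle of the extension of $\mathbb{Q}/\mathbb{Z}$ by $\mathbb{Z}$ given by $\mathbb{Q}$,
    for the section with values in $[0,1)$. *)
Definition qcarry a b : bool := 1 <= qz a + qz b.

Lemma qz_add a b : qz (a + b) = qz a + qz b - (qcarry a b)%:R.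
Proof.
have /andP[a0 a1] := qzP a; have /andP[b0 b1] := qzP b.
rewrite -[LHS]/(frac (qz a + qz b)) /qcarry; case: leP => ab.
  rewrite -[X in frac X](subrK 1) -[X in _ + X]/((1 : int)%:~R) fracDz frac_id //.
  by rewrite subr_ge0 ab ltrBlDr -[1 + 1]/(2%:R) mulr2n ltrD.
by rewrite subr0 frac_id // ab addr_ge0.
Qed.

Lemma qcarryC a b : qcarry a b = qcarry b a.
Proof. by rewrite /qcarry addrC. Qed.

Lemma qcarry0 b : qcarry 0 b = false.
Proof.
have /andP[_ b1] := qzP b; apply/negbTE; rewrite -ltNge.
by have -> : qz 0 = 0 by []; rewrite add0r.
Qed.

(** The cocycle identity: both sides are the rational sum of the three representatives minus the
    representative of the sum. *)
Lemma qcarryA a b c :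
  (qcarry b c + qcarry a (b + c)%R = qcarry a b + qcarry (a + b)%R c)%N.
Proof.
have e : qz (a + (b + c)) = qz ((a + b) + c) by rewrite addrA.
apply/eqP; rewrite -(eqr_nat rat) !natrD; apply/eqP.
by move: e; rewrite !qz_add; lra.
Qed.
End QZCarry.

(** Associativity of an addition twisted by multiples of [r], given the cocycle identity
    [i + j = l + m]. *)
Lemma add_cocycle (V : zmodType) (x y z r : V) (i j l m : nat) :
  (i + j = l + m)%N -> x + (y + z + r *+ i) + r *+ j = x + y + r *+ l + z + r *+ m.
Proof.
move=> e; rewrite !addrA -[LHS]addrA -mulrnDr e [X in _ = X + _]addrAC.
by rewrite -[RHS]addrA -mulrnDr.
Qed.

Section TateLaws.
Variables (E : comUnitRingType) (F : fgl E).

Section Points.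
Variable S : dalg (fps E).
Local Notation V := (gpt (formal_group_laws F) (res (fpsC_cmor E) S)).

Definition qhat_pt : nilp S := Nilp (qhat_subproof S).
Definition qhat_opp : V := @nilp_opp E F (res (fpsC_cmor E) S) qhat_pt.

Lemma carry_delta a b :
  carry (const_delta S a) (const_delta S b) = (qcarry a b)%:R :> S.
Proof.
rewrite /carry (@fsumE _ _ [:: (a, b)]) //=; last first.
  move=> [c d]; rewrite inE -pair_eqE /=.
  by case: (c =P a) => //= _; [case: (d =P b) => //= _; rewrite mulr0 eqxx | rewrite mul0r eqxx].
rewrite big_mkcond big_cons big_nil /= !eqxx mulr1 /qcarry.
by case: (boolP (1 <= _)) => ab; [rewrite mem_set // addr0 | rewrite memNset ?addr0 //; exact/negP].
Qed.

Lemma carry_qhat_delta a b :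
  (@nilp_opp E F (res (fpsC_cmor E) S)
    (carry_qhat (const_delta S a) (const_delta S b)) : V) = qhat_opp *+ qcarry a b.
Proof.
have -> : carry_qhat (const_delta S a) (const_delta S b) =
    (if qcarry a b then qhat_pt else nilp0 S).
  apply: nilp_inj; rewrite /= carry_delta.
  by case: (qcarry a b); rewrite ?mul1r ?mul0r.
case: (qcarry a b); first by rewrite mulr1n.
by rewrite mulr0n (@nilp_oppP E F (res (fpsC_cmor E) S) (0 : V)) oppr0.
Qed.

Lemma tate_add_delta (g h : V) a b :
  @padd _ (tate F) S (g, const_delta S a) (h, const_delta S b) =
  ((g + h + qhat_opp *+ qcarry a b : V), const_delta S (a + b)).
Proof. by rewrite /= /tate_add /= -carry_qhat_delta const_add_delta. Qed.
End Points.

Lemma carry_map (S S' : dalg (fps E)) (h : dhom S S') (e f : const_pts QZ S) :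
  h (carry e f) = carry (const_map h e) (const_map h f).
Proof.
rewrite -[carry e f]/(\sum_(ab \in [set ab | 1 <= qz ab.1 + qz ab.2]%classic) const_tens e f ab).
rewrite (rmorph_const_sum h (const_tens e f)).
by apply: eq_fsbigr => ab _; rewrite /= rmorphM.
Qed.

Lemma tate_add_map (S S' : dalg (fps E)) (h : dhom S S') (x y : tate F S) :
  pmap (tate F) h (padd (tate F) x y) = padd (tate F) (pmap (tate F) h x) (pmap (tate F) h y).
Proof.
rewrite /= /tate_add /= const_map_add; congr (_, _).
rewrite (nilp_map_add F (res_hom (fpsC_cmor E) h)) (nilp_map_add F (res_hom (fpsC_cmor E) h)).
congr nilp_add; rewrite (nilp_map_opp F (res_hom (fpsC_cmor E) h)); congr nilp_opp.
by apply: nilp_inj; rewrite /= rmorphM carry_map /= dh_str.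
Qed.

Lemma tate_separated : separated (tate F).
Proof.
move=> S I u [x e] [y f] xy.
congr (_, _).
  apply: nilp_inj; apply: (dalg_separated (u := u)) => i S' h hi.
  exact: (congr1 (fun z => nval z.1) (xy i S' h hi)).
apply: (const_gs_separated (u := u)) => i S' h hi.
exact: (congr1 snd (xy i S' h hi)).
Qed.

Lemma tate_laws : group_laws (tate F).
Proof.
have sep := tate_separated.
split.
- split=> [S h hid [x e]|S S' S'' g h l hgl [x e]]; congr (_, _);
    try apply: nilp_inj => /=; try apply: const_ptsP => a /=; by [exact: hid | exact: hgl].
- split=> [S S' h|S S' h a b]; last exact: tate_add_map.
  congr (_, _); last exact: const_map_delta.
  by apply: nilp_inj; rewrite /= rmorph0.
- move=> S; split.
  + move=> x y z; apply: (separated3 sep (e := x.2) (f := y.2) (g := z.2)) => a b c S' h xa yb zc.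
    rewrite !tate_add_map.
    have [-> -> ->] : [/\ pmap (tate F) h x = (nilp_map h x.1, const_delta S' a),
        pmap (tate F) h y = (nilp_map h y.1, const_delta S' b) &
        pmap (tate F) h z = (nilp_map h z.1, const_delta S' c)] by rewrite /= xa yb zc.
    rewrite !tate_add_delta [a + (b + c)]addrA; congr (_, _).
    exact: (@add_cocycle (gpt (formal_group_laws F) (res (fpsC_cmor E) S'))
      (nilp_map h x.1) (nilp_map h y.1) (nilp_map h z.1) _ _ _ _ _ (qcarryA a b c)).
  + move=> x y; apply: (separated2 sep (e := x.2) (f := y.2)) => a b S' h xa yb.
    rewrite !tate_add_map.
    have [-> ->] : pmap (tate F) h x = (nilp_map h x.1, const_delta S' a) /\
        pmap (tate F) h y = (nilp_map h y.1, const_delta S' b) by rewrite /= xa yb.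
    rewrite !tate_add_delta [a + b]addrC qcarryC; congr (_, _).
    pose V := gpt (formal_group_laws F) (res (fpsC_cmor E) S').
    exact: (congr1 (fun w : V => w + qhat_opp S' *+ qcarry b a)
      (@addrC V (nilp_map h x.1) (nilp_map h y.1))).
  + move=> x; apply: (separated1 sep (e := x.2)) => a S' h xa.
    rewrite tate_add_map.
    have -> : pmap (tate F) h x = (nilp_map h x.1, const_delta S' a) by rewrite /= xa.
    have -> : pmap (tate F) h (pzero (tate F) S) = (nilp0 S', const_delta S' 0).
      congr (_, _); last exact: const_map_delta.
      by apply: nilp_inj; rewrite /= rmorph0.
    rewrite (tate_add_delta (0 : gpt (formal_group_laws F) (res (fpsC_cmor E) S'))).
    by rewrite qcarry0 mulr0n addr0 !add0r.
  (* The negative is written down over [S] directly: [e'] is the negative of [e], and [c] is the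
     correction that adding [e'] and [e] introduces. *)
  + move=> [x e]; have [_ _ /(_ S) [_ _ _ /(_ e)[e' e'e]]] := const_gs_laws (fps E) QZ.
    pose V := gpt (formal_group_laws F) (res (fpsC_cmor E) S).
    pose c : V := @nilp_opp E F (res (fpsC_cmor E) S) (carry_qhat e' e).
    exists ((- ((x : V) + c) : V), e').
    rewrite -[LHS]/(((- ((x : V) + c) + (x : V) + c : V) : nilp S), const_add e' e).
    by congr (_, _) => //; rewrite -addrA addNr.
Qed.
End TateLaws.

(** * Points over products and equalizers of algebras *)

Section Lex.
Variables (A : comUnitRingType) (I : choiceType).

Section Pair.
Variables B C : dalg A.

Lemma nilp_pair_subproof (x : nilp B) (y : nilp C) :
  nilpotent ((nval x, nval y) : B * C).
Proof.
exists (nilp_order x + nilp_order y)%N.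
have e n : ((nval x, nval y) : B * C) ^+ n = (nval x ^+ n, nval y ^+ n).
  by elim: n => // n IH; rewrite !exprS IH.
by rewrite e !nilp_orderP ?leq_addr ?leq_addl.
Qed.
Definition nilp_pair x y : nilp (prod_dalg B C) := Nilp (nilp_pair_subproof x y).

Variables (e : const_pts I B) (f : const_pts I C).
Let pair_val (i : I) : B * C := (e i, f i).

Let pair_fin : finite_set [set i | pair_val i != 0].
Proof.
apply: (@sub_finite_set _ _ ([set i | e i != 0%R] `|` [set i | f i != 0%R])%classic).
  move=> i /=; rewrite -pair_eqE /= negb_and => /orP[]; [left | right] => //.
by rewrite finite_setU; split; apply: cval_fin.
Qed.

Let pair_orth i j : i != j -> pair_val i * pair_val j = 0.
Proof. by move=> ij; congr (_, _); apply: cval_orth. Qed.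

Let pair_sum : \sum_(i \in [set: I]) pair_val i = 1.
Proof.
have [r _ rP] := const_pts_seq e; have [s _ sP] := const_pts_seq f.
pose t := undup (r ++ s).
have rt i : e i != 0 -> i \in t by move/rP; rewrite mem_undup mem_cat => ->.
have st i : f i != 0 -> i \in t by move/sP; rewrite mem_undup mem_cat orbC => ->.
rewrite (@fsumE _ _ t) ?undup_uniq //; last first.
  by move=> i; rewrite -pair_eqE /= negb_and => /orP[/rt|/st].
rewrite [LHS]surjective_pairing -[1]/(1, 1) !raddf_sum /=.
by rewrite -(cval_sum e) -(cval_sum f) !(@fsumE _ _ t) ?undup_uniq.
Qed.

Definition const_pair : const_pts I (prod_dalg B C) := ConstPts pair_fin pair_orth pair_sum.
End Pair.

Section Equal.
Variables (B C : dalg A) (f g : dhom B C).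
Local Notation D := (equalizer_dalg f g).

Lemma nilp_equalizer (x : nilp B) : nilp_map f x = nilp_map g x ->
  exists y : nilp D, nilp_map (equalizer_incl f g) y = x.
Proof.
move=> /(congr1 (@nval C))/= /eqP fgx.
have ny : nilpotent (Equalizer fgx : D).
  exists (nilp_order x); apply: val_inj.
  by rewrite [LHS](rmorphXn (equalizer_incl f g)) /= nilp_orderP.
by exists (Nilp ny); apply: nilp_inj.
Qed.

Lemma const_equalizer (e : const_pts I B) : const_map f e = const_map g e ->
  exists d : const_pts I D, const_map (equalizer_incl f g) d = e.
Proof.
move=> fge.
have fgi i : e i \in equalizer_pred f g.
  by apply/eqP; exact: (congr1 (fun u => cval u i) fge).
pose d i : D := Equalizer (fgi i).
have d0 i : (d i != 0) = (e i != 0) by [].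
have d1 : finite_set [set i | d i != 0] by exact: (cval_fin e).
have d2 i j : i != j -> d i * d j = 0.
  by move=> ij; apply: val_inj; rewrite [LHS](rmorphM (equalizer_incl f g)) /= cval_orth.
have d3 : \sum_(i \in [set: I]) d i = 1.
  have [r ur rP] := const_pts_seq e; apply: val_inj.
  rewrite (@fsumE _ _ r) //; rewrite [LHS](rmorph_sum (equalizer_incl f g)) /=.
  by rewrite -[RHS](cval_sum e) (@fsumE _ _ r).
by exists (ConstPts d1 d2 d3); apply: const_ptsP.
Qed.
End Equal.
End Lex.

Section FormalGroupStr.
Variables (E : comUnitRingType) (F : fgl E) (R : comPzRingType).
Variables (s t : {rmorphism E -> R}).
Variables (sd : exists n, forall x, maxpow E n x -> s x = 0)
  (td : exists n, forall x, maxpow E n x -> t x = 0).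
Hypothesis st : s =1 t.

(** Structure maps that agree pointwise need not be convertible, for instance $E \to R \to T \to S$
    and $E \to T \to S$; this transports the addition between them. *)
Lemma nilp_add_str (x y : nilp R) :
  nilp_add F (x : nilp (DAlg sd)) y = nilp_add F (x : nilp (DAlg td)) y.
Proof.
move: (rmorphism_ext st) => e; case: t / e td => td'.
by have -> : td' = sd by apply: Prop_irrelevance.
Qed.

Lemma nilp_opp_str (x : nilp R) :
  nilp_opp F (x : nilp (DAlg sd)) = nilp_opp F (x : nilp (DAlg td)).
Proof.
move: (rmorphism_ext st) => e; case: t / e td => td'.
by have -> : td' = sd by apply: Prop_irrelevance.
Qed.
End FormalGroupStr.

(** * The Tate extension over a test ring *)

Section TateMid.
Variables (k : fieldType) (E : complete_local_ring k) (p : nat) (F : fgl E).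
Variables (T : test_ring E) (f : cont_hom T).
Local Notation M := (tate_mid p F f).
Local Notation GT := (base_change (tr_cmor T) (formal_group F)).

(** Coordinates on the fiber product: the component in $\mathbb{Q}/\mathbb{Z}$ is forced by [e], so
    points are arbitrary pairs. *)
Definition tate_mk (S : dalg T) (g : nilp S) (e : const_pts (QpZp p) S) : M S :=
  @FibPts T (tateT F f) (const_gs T (QpZp p)) (const_gs T QZ) (@tateT_proj _ _ F T f)
    (@QpZp_incl _ _ p T) S (g, const_push (@qpzp p) e) e erefl.

Lemma tate_mkE (S : dalg T) (x : M S) : x = tate_mk (fib1 x).1 (fib2 x).
Proof. by apply: fib_ext; rewrite //= [LHS]surjective_pairing; congr (_, _); exact: (fibP x). Qed.

Lemma tate_mk_map (S S' : dalg T) (h : dhom S S') g e :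
  pmap M h (tate_mk g e) = tate_mk (nilp_map h g) (const_map h e).
Proof. by apply: fib_ext => //; congr (_, _); rewrite const_push_map. Qed.

Lemma tate_incE (S : dalg T) (g : GT S) :
  ex_inc (tate_ext p F f) g = tate_mk g (const_delta S 0).
Proof. by apply: fib_ext => //; congr (_, _); rewrite const_push_delta. Qed.

Lemma tate_mid_laws : group_laws M.
Proof.
apply: fiber_product_laws; [|exact: const_gs_laws|exact: const_gs_laws].
exact/base_change_laws/tate_laws.
Qed.

Lemma testring_disc : exists n, forall x, maxpow T n x -> idfun x = 0.
Proof. by have [r [rP _]] := tr_res T; apply: maxpow_nilpotent rP (@tr_artinian _ _ T). Qed.
Definition test_dalg : dalg T := DAlg testring_disc.

(** In the coordinates of [tate_mk], points are pairs of a nilpotent element and a family of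
    idempotents, and both lift to products and equalizers. *)
Lemma tate_mid_formal : is_formal_group_scheme M.
Proof.
have [Mfun Mnat MG] := tate_mid_laws; split=> //.
apply: (is_formal_scheme_of_lex test_dalg Mfun).
- move=> B C x y; rewrite (tate_mkE x) (tate_mkE y).
  exists (@tate_mk (prod_dalg B C) (nilp_pair (fib1 x).1 (fib1 y).1)
    (const_pair (fib2 x) (fib2 y))).
  rewrite !tate_mk_map; split; congr tate_mk; try exact: nilp_inj; exact: const_ptsP.
- move=> B C u v x; rewrite (tate_mkE x) !tate_mk_map => e.
  have e1 : nilp_map u (fib1 x).1 = nilp_map v (fib1 x).1.
    exact: (congr1 (fun z : M C => (fib1 z).1) e).
  have e2 : const_map u (fib2 x) = const_map v (fib2 x).
    exact: (congr1 (fun z : M C => fib2 z) e).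
  have [[g gx] [d dx]] := (nilp_equalizer e1, const_equalizer e2).
  by exists (tate_mk g d); rewrite tate_mk_map gx dx.
Qed.

Section Points.
Variable S : dalg T.
Local Notation V := (gpt (base_change_laws (tr_cmor T) (formal_group_laws F)) S).

Definition qhat_test : nilp S := qhat_pt (res f S).

Lemma nilp_oppT (x : V) :
  @nilp_opp E F (res (tr_cmor T) S) x = - x :> V.
Proof.
by apply/eqP; rewrite -addr_eq0; apply/eqP; exact: (@nilp_addN E F (res (tr_cmor T) S)).
Qed.

Lemma tate_mk_addT (g h : V) (a b : QpZp p) :
  padd M (tate_mk g (const_delta S a)) (tate_mk h (const_delta S b)) =
  tate_mk (g + h - (qhat_test : V) *+ qcarry (qpzp a) (qpzp b) : V) (const_delta S (a + b)).
Proof.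
apply: fib_ext; last exact: const_add_delta.
have e := @tate_add_delta E F (res f S) g h (qpzp a) (qpzp b).
rewrite /= !const_push_delta; apply: (etrans e); congr (_, _).
have st : (da_str S \o f) \o @fpsC E =1 da_str S \o tr_str T.
  by move=> c; rewrite /= ch_str.
case: (qcarry _ _); last by rewrite !mulr0n addr0 subr0; exact: (nilp_add_str F _ _ st).
rewrite !mulr1n -nilp_oppT.
rewrite -[LHS]/(@nilp_add E F (res (fpsC_cmor E) (res f S))
  (@nilp_add E F (res (fpsC_cmor E) (res f S)) g h)
  (@nilp_opp E F (res (fpsC_cmor E) (res f S)) qhat_test)).
rewrite (nilp_add_str F _ (res_disc (tr_cmor T) S) st).
rewrite (nilp_opp_str F _ (res_disc (tr_cmor T) S) st).
by rewrite (nilp_add_str F _ (res_disc (tr_cmor T) S) st).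
Qed.
End Points.

Lemma tate_ext_is_extension : is_extension (tate_ext p F f).
Proof.
split; first exact: tate_mid_formal.
- split; last by [].
  split=> [S S' h g|S|S g g'].
  + by rewrite !tate_incE tate_mk_map const_map_delta.
  + by rewrite tate_incE; apply: fib_ext => //; congr (_, _); rewrite /= const_push_delta.
  + by rewrite !tate_incE tate_mk_addT qcarry0 mulr0n subr0 addr0.
- by move=> S g g' /(congr1 (fun x : M S => (fib1 x).1)).
- move=> S x; split=> [x0|[g <-] //].
  exists (fib1 x).1; rewrite tate_incE [RHS]tate_mkE; congr tate_mk; exact: esym.
- by move=> S a; exists (tate_mk (nilp0 S) a).
Qed.
End TateMid.

(** * Points of an extension *)

Section ExtensionPoints.
Variables (K : comUnitRingType) (A : zmodType) (G : group_functor K).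
Variables (X : exseq A G) (HX : is_extension X).

Lemma ext_mid_laws : group_laws (ex_mid X).
Proof. by case: HX => /formal_group_laws_of_scheme. Qed.

Lemma ext_proj_eq S (x y : ex_mid X S) : ex_proj x = ex_proj y ->
  exists g, x = padd (ex_mid X) (ex_inc X g) y.
Proof.
have [_ [_ [_ p0 pD]] _ ker _] := HX => xy.
pose V := gpt ext_mid_laws S.
have [|g gx] := (ker S ((x : V) - (y : V))).1.
  rewrite -[(x : V) - (y : V)]/(padd (ex_mid X) x (- (y : V))) pD xy -pD -p0.
  by congr ex_proj; exact: (subrr (y : V)).
by exists g; rewrite gx; exact: (esym (subrK (y : V) x)).
Qed.

(** Two locally equal points have equal projections, since constant groups are separated. They thus
    differ by a point of [G] that vanishes locally, hence vanishes. *)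
Lemma ext_separated : separated G -> separated (ex_mid X).
Proof.
have [_ [[in_ i0 iD] [pn _ _]] inj _ _] := HX => Gsep.
have [_ [XP0 XPD] _] := ext_mid_laws.
move=> S I u x y xy.
have pxy : ex_proj x = ex_proj y.
  apply: (const_gs_separated (u := u)) => i S' h hi.
  by rewrite -!pn (xy i).
have [g xg] := ext_proj_eq pxy; rewrite {}xg in xy *.
suff -> : g = pzero G S by rewrite i0; exact: (add0r (y : gpt ext_mid_laws S)).
apply: (Gsep _ _ u) => i S' h hi; apply: inj.
rewrite !in_ i0 XP0.
apply: (@addIr (gpt ext_mid_laws S') (pmap (ex_mid X) h y)).
rewrite [RHS](add0r (pmap (ex_mid X) h y : gpt ext_mid_laws S')).
exact: (etrans (esym (XPD _ _ _ _ _)) (xy i S' h hi)).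
Qed.
End ExtensionPoints.

Section ConstSection.
Variables (k : fieldType) (E : complete_local_ring k) (F : fgl E).
Variables (T : test_ring E) (A : zmodType).
Local Notation G := (base_change (tr_cmor T) (formal_group F)).
Variables (X : exseq A G) (HX : is_extension X).

Lemma base_formal_separated : separated G.
Proof.
move=> S I u x y xy; apply: nilp_inj; apply: (dalg_separated (u := u)) => i S' h hi.
exact: (congr1 (@nval S') (xy i S' h hi)).
Qed.

Lemma nilp_glue (S : dalg T) (I : choiceType) (u : const_pts I S)
    (g : forall i, G (loc_dalg (cval_idem u i))) :
  exists g0 : G S, forall i, pmap G (loc_hom (cval_idem u i)) g0 = g i.
Proof.
have nilp_val i : nilpotent (loc_val (nval (g i))).
  (* The exponent is raised by one because zeroth powers do not match: the unit of the localization
     is the idempotent. *)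
  have [n gn] := nvalP (g i); exists n.+1; rewrite -[RHS]/(loc_val (0 : loc_dalg (cval_idem u i))).
  rewrite -(mul0r (nval (g i))) -gn -exprSr.
  elim: (n) => [|m IH]; first by rewrite !expr1.
  by rewrite exprS IH [in RHS]exprS.
have [r rP] := @cval_glue _ _ u (fun i => loc_val (nval (g i))) (fun i => loc_valE _).
have nr : nilpotent (\sum_(j <- r) loc_val (nval (g j))).
  by elim/big_ind: _ => //; [exact: nilpotent0 | exact: nilpotentD].
by exists (Nilp nr) => i; apply: nilp_inj; apply: val_inj; exact: rP.
Qed.

Definition test_str (S : dalg T) : dhom (test_dalg T) S :=
  @DHom T (test_dalg T) S (da_str S) (fun=> erefl).

Lemma test_str_map (S S' : dalg T) (h : dhom S S') (x : ex_mid X (test_dalg T)) :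
  pmap (ex_mid X) h (pmap (ex_mid X) (test_str S) x) = pmap (ex_mid X) (test_str S') x.
Proof.
have [[_ XM] _ _] := ext_mid_laws HX.
by rewrite -(XM _ _ _ _ _ (test_str S')) // => t; rewrite /= dh_str.
Qed.

Variable s : A -> ex_mid X (test_dalg T).
Hypothesis sP : forall a, ex_proj (s a) = const_delta _ a.

(* x is the point of X above e that equals s a on the locus where e = a. *)
Definition is_const_lift (S : dalg T) (e : const_pts A S) (x : ex_mid X S) : Prop :=
  forall a S' (h : dhom S S'), const_map h e = const_delta S' a ->
    pmap (ex_mid X) h x = pmap (ex_mid X) (test_str S') (s a).

Lemma const_lift_unique (S : dalg T) (e : const_pts A S) x y :
  is_const_lift e x -> is_const_lift e y -> x = y.
Proof.
move=> xP yP; apply: (separated1 (ext_separated HX base_formal_separated) (e := e)) => a S' h ha.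
by rewrite (xP a S' h ha) (yP a S' h ha).
Qed.

Lemma const_lift_proj (S : dalg T) (e : const_pts A S) x : is_const_lift e x -> ex_proj x = e.
Proof.
have [_ [_ [pn _ _]] _ _ _] := HX => xP.
apply: (separated1 (@const_gs_separated T A) (e := e)) => a S' h ha.
rewrite -pn (xP a S' h ha) pn sP; exact: (etrans (const_map_delta _ _) (esym ha)).
Qed.

(** Any lift [x0] of [e] differs from [s a], on the locus where [e] is [a], by a point of [G]. These
    differences glue to one [g], and [x0 - g] is the lift sought. *)
Lemma const_lift_ex (S : dalg T) (e : const_pts A S) : exists x, is_const_lift e x.
Proof.
have [_ [[in_ i0 iD] [pn _ _]] inj _ psurj] := HX.
have [[_ XM] [XP0 XPD] _] := ext_mid_laws HX.
have [x0 x0e] := psurj S e.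
have gex a : exists g : G (loc_dalg (cval_idem e a)),
    pmap (ex_mid X) (loc_hom (cval_idem e a)) x0 = padd (ex_mid X) (ex_inc X g)
      (pmap (ex_mid X) (test_str _) (s a)).
  apply: ext_proj_eq => //; rewrite !pn sP x0e.
  rewrite [LHS]/= (const_map_eq1 (loc_hom1 (cval_idem e a))); exact/esym/const_map_delta.
have [g gP] := nilp_glue (fun a => sval (cid (gex a))).
pose V S := gpt (ext_mid_laws HX) S.
exists ((x0 : V S) - (ex_inc X g : V S)) => a S' h ha.
have ha1 : h (e a) = 1 by rewrite -[LHS]/(const_map h e a) ha /= eqxx.
(* As [h] sends [e a] to 1, it factors through the localization there, so the equality need only be
   checked on that localization. *)
pose h' := loc_lift (cval_idem e a) ha1.
have hE (y : ex_mid X S) : pmap (ex_mid X) h y =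
    pmap (ex_mid X) h' (pmap (ex_mid X) (loc_hom (cval_idem e a)) y).
  by apply: XM => z; rewrite loc_liftE.
rewrite {}hE -(test_str_map h'); congr (pmap (ex_mid X) h' _).
apply: (@addIr (V _) (pmap (ex_mid X) (loc_hom (cval_idem e a)) (ex_inc X g))).
change (padd (ex_mid X)
   (pmap (ex_mid X) (loc_hom (cval_idem e a)) ((x0 : V S) - (ex_inc X g : V S)))
   (pmap (ex_mid X) (loc_hom (cval_idem e a)) (ex_inc X g)) =
  padd (ex_mid X) (pmap (ex_mid X) (test_str (loc_dalg (cval_idem e a))) (s a))
   (pmap (ex_mid X) (loc_hom (cval_idem e a)) (ex_inc X g))).
rewrite -XPD -[padd _ _ (ex_inc X g)]/((x0 : V S) - (ex_inc X g : V S) + (ex_inc X g : V S)) subrK.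
rewrite (svalP (cid (gex a))) -in_ gP.
exact: (@addrC (V _)).
Qed.

Definition const_lift (S : dalg T) (e : const_pts A S) : ex_mid X S :=
  sval (cid (const_lift_ex e)).

Lemma const_liftP (S : dalg T) (e : const_pts A S) : is_const_lift e (const_lift e).
Proof. exact: svalP (cid (const_lift_ex e)). Qed.

Lemma const_lift_map (S S' : dalg T) (h : dhom S S') (e : const_pts A S) :
  pmap (ex_mid X) h (const_lift e) = const_lift (const_map h e).
Proof.
have [[_ XM] _ _] := ext_mid_laws HX.
apply: (const_lift_unique _ (@const_liftP _ _)) => a S'' h' h'a.
rewrite -(XM _ _ _ h h' (dhom_comp h' h)) //; apply: const_liftP.
by rewrite -h'a; apply: const_ptsP.
Qed.

Lemma const_lift_delta (S : dalg T) a :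
  const_lift (const_delta S a) = pmap (ex_mid X) (test_str S) (s a).
Proof.
have [[X1 _] _ _] := ext_mid_laws HX.
rewrite -[LHS](X1 _ (dhom_id S)) //; apply: const_liftP; exact: const_map_delta.
Qed.
End ConstSection.

(** * Torsion *)

Section TestRingTorsion.
Variables (k : fieldType) (p : nat) (p_char : p \in [pchar k]).
Variables (E : complete_local_ring k) (F : fgl E) (T : test_ring E).
Local Notation V := (gpt (base_change_laws (tr_cmor T) (formal_group_laws F)) (test_dalg T)).

Lemma nilp_nonunit (x : nilp T) : nval x \isn't a GRing.unit.
Proof.
have [r [[_ rP] _]] := tr_res T; have [n xn] := nvalP x.
rewrite rP negbK -[_ == 0]andTb; have := congr1 r xn.
by rewrite rmorphXn rmorph0 => /eqP; rewrite expf_eq0 => /andP[_ ->].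
Qed.

(** Modulo the next power of the maximal ideal the group law is ordinary addition, because the mixed
    term of [nilp_add_quad] has a second nonunit factor. *)
Lemma gpt_mul_maxpow (x : V) n m : maxpow T n (nval (x : nilp T)) ->
  maxpow T n.+1 (nval (x *+ m : nilp T) - m%:R * nval (x : nilp T)).
Proof.
move=> xn; have [J0 JD JM] := @maxpow_ideal T n.+1.
elim: m => [|m IH].
  by rewrite mul0r subr0; exact: J0.
have [t tP] := nilp_add_quad F (S := res (tr_cmor T) (test_dalg T)) x (x *+ m).
rewrite mulrS -[nval _]/(nval (@nilp_add E F (res (tr_cmor T) (test_dalg T)) x (x *+ m))) tP.
set y := nval (x *+ m : nilp T) in IH *; set x' := nval (x : nilp T) in xn IH *.
have -> : x' + y + x' * y * t - m.+1%:R * x' = (y - m%:R * x') + t * (y * x').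
  by rewrite -natr1; ring.
by apply: JD => //; apply: JM; apply: maxpow_mul => //; exact: nilp_nonunit.
Qed.

Lemma gpt_torsion : exists2 N, (0 < N)%N & forall x : V, x *+ (p ^ N) = 0.
Proof.
have [r [[_ rP] re]] := tr_res T; have [N NP] := testring_disc T.
(* The exponent [N] would do; the successor makes it positive. *)
exists N.+1 => // x; apply: nilp_inj; apply: NP.
suff h n : maxpow T n (nval (x *+ (p ^ n) : nilp T)).
  exact: (@maxpow_le _ _ _ _ (leqnSn N)) (h N.+1).
elim: n => [//|n IH]; rewrite expnSr mulrnA.
have [J0 JD JM] := @maxpow_ideal T n.+1.
rewrite -[nval _](subrK (p%:R * nval (x *+ (p ^ n) : nilp T))); apply: JD.
  exact: gpt_mul_maxpow.
apply: maxpow_mul => //; rewrite rP negbK rmorph_nat; exact/eqP/pcharf0.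
Qed.
End TestRingTorsion.

(** * Division by powers of p in $\mathbb{Q}_p/\mathbb{Z}_p$ *)

Lemma QZ_ofD x y : QZ_of (x + y) = QZ_of x + QZ_of y.
Proof. by apply: val_inj; rewrite /= frac_fracl frac_fracr. Qed.

Lemma QZ_ofMn x n : QZ_of (x *+ n) = QZ_of x *+ n.
Proof. by elim: n => [//|n IH]; rewrite !mulrS QZ_ofD IH. Qed.

Lemma QZ_ofK (a : QZ) : QZ_of (qz a) = a.
Proof. by apply: val_inj; rewrite /= frac_id ?qzP. Qed.

Lemma QZ_of1 : QZ_of 1 = 0.
Proof. by apply: val_inj; rewrite /= -[1]add0r -[X in _ + X]/((1 : int)%:~R) fracDz. Qed.

Section QpZpDivision.
Variables (p N : nat) (p_prime : prime p) (N_gt0 : (0 < N)%N).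
Local Notation P := (p ^ N)%N.

Lemma p_denom_div (x : rat) : p.-nat `|denq x|%N -> p.-nat `|denq (frac (x / P%:R))|%N.
Proof.
move=> /p_natP[m pm /intrP[z mx]]; apply/p_natP; exists (m * P)%N.
  by rewrite pnatM pm pnatX pnat_id // orbT.
rewrite /frac mulrBr; apply: rpredB; last by rewrite rpredM ?natr_int ?intr_int.
have -> : (m * P)%:R * (x / P%:R) = m%:R * x; last by rewrite mx intr_int.
rewrite natrM mulrACA divff ?mulr1 //.
by rewrite pnatr_eq0 expn_eq0 -leqn0 leqNgt prime_gt0.
Qed.

Lemma p_denom1 : p.-nat `|denq (1 : rat)|%N. Proof. by []. Qed.

(** Division of the representative in $[0,1)$. It is not additive: its defect is $1/p^N$ at each
    carry, by [QpZp_divD]. *)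
Definition QpZp_div (a : QpZp p) : QpZp p :=
  @MkQpZp p (QZ_of (qz a / P%:R)) (p_denom_div (qpzpP a)).
Definition QpZp_unit : QpZp p := @MkQpZp p (QZ_of (1 / P%:R)) (p_denom_div p_denom1).

Lemma QpZp_valMn (a : QpZp p) n : qpzp (a *+ n) = qpzp a *+ n.
Proof. exact: (raddfMn (val : {additive QpZp p -> QZ})). Qed.

Let P_gt1 : (1 < P)%N.
Proof. by rewrite -{1}(expn0 p) ltn_exp2l // prime_gt1. Qed.
Let P_neq0 : P%:R != 0 :> rat.
Proof. by rewrite pnatr_eq0 -lt0n ltnW. Qed.

Lemma QpZp_divK a : QpZp_div a *+ P = a.
Proof.
apply: val_inj; rewrite /= QpZp_valMn -QZ_ofMn -[RHS]QZ_ofK; congr QZ_of.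
by rewrite -[_ / _ *+ _]mulr_natr mulfVK.
Qed.

Lemma QpZp_unitMP : QpZp_unit *+ P = 0.
Proof.
apply: val_inj; rewrite /= QpZp_valMn -QZ_ofMn -[_ / _ *+ _]mulr_natr mulfVK //.
by rewrite QZ_of1.
Qed.

(** This is [qz_add] divided by $p^N$. *)
Lemma QpZp_divD a b :
  QpZp_div a + QpZp_div b = QpZp_div (a + b) + QpZp_unit *+ qcarry (qpzp a) (qpzp b).
Proof.
apply: (@val_inj _ _ (QpZp p)).
change (qpzp (QpZp_div a) + qpzp (QpZp_div b) =
  qpzp (QpZp_div (a + b)) + qpzp (QpZp_unit *+ qcarry (qpzp a) (qpzp b))).
rewrite QpZp_valMn /= -QZ_ofMn -!QZ_ofD; congr QZ_of.
by rewrite -[frac _]/(qz (qpzp a + qpzp b)) qz_add -mulrnAl -!mulrDl subrK.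
Qed.

Lemma qz_QpZp_unitMn j : (j < P)%N -> qz (qpzp (QpZp_unit *+ j)) = j%:R / P%:R.
Proof.
move=> jP; rewrite QpZp_valMn -QZ_ofMn /= -mulrnAl frac_id // divr_ge0 ?ler0n //=.
by rewrite ltr_pdivrMr ?mul1r ?ltr_nat // ltr0n ltnW.
Qed.

Lemma QpZp_unit_carry j : (j < P)%N ->
  qcarry (qpzp QpZp_unit) (qpzp (QpZp_unit *+ j)) = (j.+1 == P).
Proof.
move=> jP; rewrite /qcarry qz_QpZp_unitMn // -[QpZp_unit]mulr1n qz_QpZp_unitMn //.
rewrite -mulrDl ler_pdivlMr ?mul1r ?ltr0n ?(ltnW P_gt1) //.
by rewrite -natrD ler_nat add1n eqn_leq jP.
Qed.
End QpZpDivision.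

(** * Continuous homomorphisms from $E[[\hat q]]$ to a test ring *)

Section ContHom.
Variables (k : fieldType) (E : complete_local_ring k) (T : test_ring E).

(** A series is a polynomial of degree below [n] plus a multiple of the [n]-th power of the
    variable, and the latter goes to zero. *)
Lemma cont_homE (f : cont_hom T) (q : nilp T) (h : fps E) :
  f (fpsX E) = nval q -> f h = fps_eval (tr_str T) q h.
Proof.
move=> fX; pose n := nilp_order q; have qn : nval q ^+ n = 0 by apply: nilp_orderP.
have -> : h = \sum_(i < n) fpsC (fcoef h i) * fpsX E ^+ i +
    fpsX E ^+ n * FPS (fun i => fcoef h (n + i)).
  apply: fpsP => m; rewrite fcoefD fcoef_sum fcoefXnM.
  under eq_bigr => i _ do rewrite fcoefCM -[fpsX E ^+ i]mulr1 fcoefXnM.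
  case: leqP => nm /=.
    rewrite subnKC // big1 ?add0r // => i _; rewrite ltnW ?(leq_trans (ltn_ord i)) //.
    by rewrite -(prednK (n := m - i)) ?mulr0 // subn_gt0 (leq_trans _ nm).
  rewrite addr0 (bigD1 (Ordinal nm)) //= leqnn subnn mulr1 big1 ?addr0 // => i im.
  case: leqP => [|_]; last by rewrite mulr0.
  rewrite leq_eqVlt => /orP[/eqP e|lt_im]; last first.
    by rewrite -(prednK (n := m - i)) ?mulr0 // subn_gt0.
  by case/eqP: im; apply: val_inj.
rewrite !rmorphD /= !rmorphM /= !rmorphXn /= fX fps_evalX qn !mul0r !addr0 !rmorph_sum.
by apply: eq_bigr => i _; rewrite /= !rmorphM /= !rmorphXn /= fX fps_evalX fps_evalC ch_str.
Qed.

Lemma cont_hom_ext (f g : cont_hom T) : f (fpsX E) = g (fpsX E) -> f = g.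
Proof.
(* By continuity a power of the variable goes into a power of the maximal ideal of [T] that is
   zero. *)
move=> fgX; have nq : nilpotent (f (fpsX E)).
  have [n nP] := testring_disc T; have [m mP] := cm_cont f n.
  exists m; rewrite -rmorphXn; apply: nP; apply: mP; apply: maxpow_exp.
  by rewrite -[_ \is a _]/(fcoef (fpsX E) 0 \is a GRing.unit) unitr0.
have fg h : f h = g h.
  by rewrite (@cont_homE f (Nilp nq)) // (@cont_homE g (Nilp nq)).
case: f g fg {fgX nq} => [[f fc] fs] [[g gc] gs] /= /rmorphism_ext e.
case: g / e gc gs => gc; have -> : gc = fc by apply: Prop_irrelevance.
by move=> gs; congr ContHom; apply: Prop_irrelevance.
Qed.

(** Evaluation at [q] is a local map, since [q] vanishes in the residue field and only the constant
    coefficient survives there; hence it is continuous. *)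
Lemma cont_hom_exists (q : nilp T) : exists f : cont_hom T, f (fpsX E) = nval q.
Proof.
have [r [[rs rP] re]] := tr_res T.
have rq : r (nval q) = 0.
  by have := nilp_nonunit q; rewrite rP negbK => /eqP.
have cont : adic_continuous (fps_eval (tr_str T) q).
  apply: local_continuous => h; rewrite rP /=.
  rewrite (@fps_evalE _ _ _ _ (nilp_order q).+1) ?nilp_orderP // rmorph_sum big_ord_recl.
  rewrite big1 => [|i _]; last by rewrite rmorphM rmorphXn /= rq expr0n mulr0.
  rewrite addr0 mulr1 re -(clr_resP E).2.
  by rewrite -[h \is a _]/(fcoef h 0 \is a GRing.unit).
pose f : cmor (fps E) T := CMor cont.
have fs e : f (fpsC e) = tr_str T e by rewrite /= fps_evalC.
by exists (ContHom fs); rewrite /= fps_evalX.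
Qed.
End ContHom.

(** * Comparison with the Tate extension *)

Section ExtIso.
Variables (K : comUnitRingType) (A : zmodType) (G : group_functor K).
Implicit Types X Y Z : exseq A G.

Lemma is_hom_comp (X Y Z : group_functor K) (f : forall S, X S -> Y S) (g : forall S, Y S -> Z S) :
  is_hom f -> is_hom g -> is_hom (fun S => g S \o f S).
Proof.
move=> [fn f0 fD] [gn g0 gD]; split=> [S S' h a|S|S a b] /=.
- by rewrite fn gn.
- by rewrite f0 g0.
- by rewrite fD gD.
Qed.

Lemma ext_iso_refl X : ext_iso X X.
Proof. by exists (fun S => id), (fun S => id). Qed.

Lemma ext_iso_sym X Y : ext_iso X Y -> ext_iso Y X.
Proof.
move=> [f [f' [[fh fh'] fK fi fp]]]; exists f', f; split=> //.
- by move=> S; have [] := fK S.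
- by move=> S g; rewrite -fi (fK S).1.
- by move=> S x; rewrite -fp (fK S).2.
Qed.

Lemma ext_iso_trans Y X Z : ext_iso X Y -> ext_iso Y Z -> ext_iso X Z.
Proof.
move=> [f [f' [[fh fh'] fK fi fp]]] [g [g' [[gh gh'] gK gi gp]]].
exists (fun S => g S \o f S), (fun S => f' S \o g' S); split.
- by split; apply: is_hom_comp.
- by move=> S; split=> x /=; rewrite ?(gK S).1 ?(fK S).1 ?(fK S).2 ?(gK S).2.
- by move=> S x /=; rewrite fi gi.
- by move=> S x /=; rewrite gp fp.
Qed.

Lemma ext_class_eq X Y : ext_iso X Y -> ext_class X = ext_class Y.
Proof.
move=> XY; apply/funext => Z; apply/propext; split=> -[HZ iZ]; split=> //.
  exact: ext_iso_trans (ext_iso_sym XY) iZ.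
exact: ext_iso_trans XY iZ.
Qed.

(** The short five lemma on points; the inverse is obtained by choice, and injectivity makes it a
    homomorphism. *)
Lemma ext_iso_of_hom X Y (f : forall S, ex_mid X S -> ex_mid Y S) :
  is_extension X -> is_extension Y -> is_hom f ->
  (forall S (g : G S), f S (ex_inc X g) = ex_inc Y g) ->
  (forall S (x : ex_mid X S), ex_proj (f S x) = ex_proj x) -> ext_iso X Y.
Proof.
move=> HX HY [fn f0 fD] fi fp.
have [_ [[_ iX0 _] _] injX _ surX] := HX; have [_ [[_ iY0 _] _] injY _ _] := HY.
pose VX S := gpt (ext_mid_laws HX) S; pose VY S := gpt (ext_mid_laws HY) S.
have finj S : injective (f S).
  move=> x y fxy; have [|g xg] := ext_proj_eq HX (x := x) (y := y).
    by rewrite -fp fxy fp.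
  suff g0 : g = pzero G S by rewrite xg g0 iX0; exact: (add0r (y : VX S)).
  apply: injY; rewrite iY0; apply: (@addIr (VY S) (f S y)).
  rewrite [RHS](add0r (f S y : VY S)) -{2}fxy xg fD fi; exact: erefl.
have fsur S y : exists x, f S x = y.
  have [x xy] := surX S (ex_proj y).
  have [|g yg] := ext_proj_eq HY (x := y) (y := f S x); first by rewrite fp xy.
  by exists (padd (ex_mid X) (ex_inc X g) x); rewrite fD fi -yg.
pose f' S y := sval (cid (fsur S y)).
have f'K S : cancel (f' S) (f S) by move=> y; exact: (svalP (cid (fsur S y))).
exists f, f'; split=> //; last by move=> S; split=> // x; apply: finj; rewrite f'K.
split=> //; split=> [S S' h y|S|S x y]; apply: finj; rewrite f'K.
- by rewrite fn f'K.
- by rewrite f0.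
- by rewrite fD !f'K.
Qed.
End ExtIso.

Section ExtMn.
Variables (K : comUnitRingType) (A : zmodType) (G : group_functor K).
Variables (X : exseq A G) (HX : is_extension X) (GL : group_laws G).
Local Notation V S := (gpt (ext_mid_laws HX) S).

Lemma ext_incMn S (g : gpt GL S) n :
  ex_inc X (g *+ n : gpt GL S) = (ex_inc X g : V S) *+ n :> V S.
Proof.
have [_ [[_ i0 iD] _] _ _ _] := HX; elim: n => [|n IH]; first exact: i0.
by rewrite !mulrS -IH; exact: iD.
Qed.

Lemma ext_projMn S (x : V S) a n : ex_proj x = const_delta S a ->
  ex_proj (x *+ n : V S) = const_delta S (a *+ n).
Proof.
have [_ [_ [_ p0 pD]] _ _ _] := HX => xa; elim: n => [|n IH]; first exact: p0.
by rewrite !mulrS -const_add_delta -IH -xa; exact: pD.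
Qed.

(** Two lifts differ by a point of [G], which [n] kills. So [n] times a lift depends only on the
    point lifted. *)
Lemma ext_torsion S n : (forall g : gpt GL S, g *+ n = 0) ->
  forall x y : V S, ex_proj x = ex_proj y -> x *+ n = y *+ n.
Proof.
have [_ [[_ i0 iD] _] _ _ _] := HX => Gn x y xy.
have [g ->] := ext_proj_eq HX xy.
rewrite -[padd _ _ y]/((ex_inc X g : V S) + y) mulrnDl -(ext_incMn g) Gn.
by rewrite -[RHS]add0r; congr (_ + _); exact: i0.
Qed.
End ExtMn.

(* With w the defect of additivity at a carry, adding [1/p^N] to itself p^N
   times produces exactly one carry. *)
Lemma carry_sum (p N : nat) (p_prime : prime p) (N_gt0 : (0 < N)%N) (V : zmodType)
    (s : QpZp p -> V) (w : V) :
  (forall a b, s a + s b = s (a + b) + w *+ qcarry (qpzp a) (qpzp b)) ->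
  s (QpZp_unit N p_prime) *+ (p ^ N) = w.
Proof.
move=> sD; set u := QpZp_unit _ _.
have s0 : s 0 = 0.
  by apply: (@addIr _ (s 0)); rewrite sD qcarry0 mulr0n !add0r addr0.
have sMn j : (j < p ^ N)%N -> s u *+ j = s (u *+ j).
  elim: j => [|j IH] jP; first by rewrite s0.
  rewrite mulrS IH ?(ltnW jP) // sD QpZp_unit_carry ?(ltnW jP) //.
  by rewrite (ltn_eqF jP) mulr0n addr0 mulrS.
have P0 : (0 < p ^ N)%N by rewrite expn_gt0 prime_gt0.
rewrite -(prednK P0) mulrS sMn ?prednK // sD QpZp_unit_carry ?prednK //.
by rewrite eqxx -mulrS prednK // QpZp_unitMP // s0 add0r.
Qed.

Section TestRingExt.
Variables (k : fieldType) (p : nat) (p_char : p \in [pchar k]).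
Variables (E : complete_local_ring k) (F : fgl E) (T : test_ring E).
Local Notation G := (base_change (tr_cmor T) (formal_group F)).
Let GL : group_laws G := base_change_laws (tr_cmor T) (formal_group_laws F).
Let p_prime : prime p := pcharf_prime p_char.
Local Notation D := (test_dalg T).

Lemma ext_cocycle (X : exseq (QpZp p) G) (HX : is_extension X) :
  exists (s : QpZp p -> gpt (ext_mid_laws HX) D) (c : gpt GL D),
    (forall a, ex_proj (s a) = const_delta D a) /\
    forall a b, s a + s b = s (a + b) +
      (ex_inc X c : gpt (ext_mid_laws HX) D) *+ qcarry (qpzp a) (qpzp b).
Proof.
have [N N0 tor] := gpt_torsion p_char F T.
have [_ [_ [_ p0 pD]] _ ker sur] := HX.
pose V := gpt (ext_mid_laws HX) D.
(* Arbitrary lifts; no additivity is asked of them, as only their multiples by $p^N$ are used for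
   the section. *)
pose y a : V := sval (cid (sur D (const_delta D a))).
have yP a : ex_proj (y a) = const_delta D a by exact: (svalP (cid (sur D (const_delta D a)))).
pose u := QpZp_unit N p_prime.
have [c cP] : exists c : gpt GL D, ex_inc X c = y u *+ (p ^ N).
  apply: (ker D (y u *+ (p ^ N))).1.
  by rewrite (ext_projMn _ (yP u)) QpZp_unitMP.
exists (fun a => y (QpZp_div N p_prime a) *+ (p ^ N)), c; split=> [a|a b].
  by rewrite (ext_projMn _ (yP _)) QpZp_divK.
(* Both sides are now $p^N$ times lifts of the two sides of [QpZp_divD], so they agree by
   [ext_torsion]. *)
rewrite [in RHS]cP mulrnAC -!mulrnDl; apply: (ext_torsion (HX := HX) tor).
have yD (v w : V) : ex_proj (v + w) = const_add (ex_proj v) (ex_proj w) by exact: pD.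
by rewrite !yD (ext_projMn _ (yP u)) !yP !const_add_delta QpZp_divD.
Qed.

Definition tate_section (f : cont_hom T) (a : QpZp p) :
    gpt (ext_mid_laws (tate_ext_is_extension p F f)) D :=
  tate_mk F f (nilp0 D) (const_delta D a).

Lemma tate_section_carry (f : cont_hom T) a b :
  tate_section f a + tate_section f b = tate_section f (a + b) +
    (ex_inc (tate_ext p F f) (- (qhat_test f D : gpt GL D)) :
       gpt (ext_mid_laws (tate_ext_is_extension p F f)) D)
      *+ qcarry (qpzp a) (qpzp b).
Proof.
have zero_carry (x : QpZp p) : qcarry (qpzp x) (qpzp (0 : QpZp p)) = false.
  by rewrite qcarryC qcarry0.
rewrite -[LHS]/(padd (tate_mid p F f) _ _).
rewrite (tate_mk_addT f (0 : gpt GL D) (0 : gpt GL D)) add0r.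
case: (qcarry (qpzp a) (qpzp b)); last by rewrite !mulr0n subr0 addr0.
rewrite !mulr1n tate_incE.
rewrite -[RHS]/(padd (tate_mid p F f) _ _).
rewrite (tate_mk_addT f (0 : gpt GL D) (- (qhat_test f D : gpt GL D))).
by rewrite zero_carry mulr0n subr0 !addr0.
Qed.

(** By [carry_sum], $p^N$ times a lift of $1/p^N$ is the image of minus the value of $\hat q$; an
    isomorphism of extensions preserves it. *)
Lemma tate_ext_inj (f f' : cont_hom T) :
  ext_iso (tate_ext p F f) (tate_ext p F f') -> f = f'.
Proof.
move=> [h [_ [[[_ h0 hD] _] _ hi hp]]].
have [N N0 tor] := gpt_torsion p_char F T.
pose H (f0 : cont_hom T) := tate_ext_is_extension p F f0.
have carry f0 := carry_sum p_prime N0 (@tate_section_carry f0).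
have hMn (x : gpt (ext_mid_laws (H f)) D) n :
    h D (x *+ n) = (h D x : gpt (ext_mid_laws (H f')) D) *+ n.
  by elim: n => [|n IH]; [exact: h0 | rewrite !mulrS -IH; exact: hD].
have := congr1 (h D) (carry f); rewrite hMn hi.
(* The image of the first section at $1/p^N$ need not be the second section, but both lift the same
   point and so have the same multiple by $p^N$. *)
rewrite (ext_torsion (HX := H f') tor (y := tate_section f' (QpZp_unit N p_prime))); last first.
  by rewrite hp.
rewrite (carry f').
have [_ _ inj _ _] := H f'.
move=> /inj /(@oppr_inj (gpt GL D)) /(congr1 (@nval D)) e.
by apply: cont_hom_ext; exact: esym e.
Qed.

Lemma tate_ext_surj (X : exseq (QpZp p) G) : is_extension X ->
  exists f : cont_hom T, ext_iso (tate_ext p F f) X.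
Proof.
move=> HX; have [s [c [sP sD]]] := ext_cocycle HX.
(* The sign reverses because a carry in the Tate group subtracts $\hat q$. *)
have [f fX] := cont_hom_exists ((- c : gpt GL D) : nilp D).
exists f; pose V S := gpt (ext_mid_laws HX) S; pose VG S := gpt GL S.
have [_ [[in_ i0 iD] [pn p0 pD]] _ _ _] := HX.
have [[X1 XM] [XP0 XPD] _] := ext_mid_laws HX.
have [_ [GP0 GPD] _] := GL.
pose cS S : VG S := pmap G (test_str S) c.
have qS S : - (qhat_test f S : VG S) = cS S.
  apply: (@addIr (VG S) (qhat_test f S)); rewrite addNr.
  have -> : qhat_test f S = pmap G (test_str S) (- c : gpt GL D).
    by apply: nilp_inj; rewrite /= fX.
  rewrite -[RHS]/(padd G (pmap G (test_str S) c) (pmap G (test_str S) (- c : gpt GL D))).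
  by rewrite -GPD -[padd G c _]/(c + - c) subrr; rewrite GP0.
pose sS S a : V S := pmap (ex_mid X) (test_str S) (s a).
have sSD S a b : sS S a + sS S b =
    sS S (a + b) + (ex_inc X (cS S) : V S) *+ qcarry (qpzp a) (qpzp b).
  rewrite -[LHS]/(padd (ex_mid X) _ _) -XPD -[padd (ex_mid X) (s a) _]/(s a + s b) sD.
  rewrite -[s (a + b) + _]/(padd (ex_mid X) _ _) XPD /cS in_.
  rewrite -[RHS]/(padd (ex_mid X) _ _); congr padd.
  by case: (qcarry _ _); [rewrite !mulr1n | rewrite !mulr0n XP0].
pose lift (S : dalg T) (e : const_pts (QpZp p) S) : V S := const_lift HX sP e.
have lift_delta S a : lift S (const_delta S a) = sS S a by exact: const_lift_delta.
pose phi S (x : tate_mid p F f S) : V S := (ex_inc X (fib1 x).1 : V S) + lift S (fib2 x).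
have phi_mk S (g : VG S) e : phi S (tate_mk F f g e) = (ex_inc X g : V S) + lift S e by [].
have phin S S' (h : dhom S S') x : phi S' (pmap (tate_mid p F f) h x) = pmap (ex_mid X) h (phi S x).
  rewrite [x in LHS]tate_mkE tate_mk_map phi_mk /phi -[_ + lift S _]/(padd (ex_mid X) _ _) XPD.
  by rewrite /lift const_lift_map -in_.
have s0 : s 0 = 0 by apply: (@addIr _ (s 0)); rewrite sD qcarry0 mulr0n !add0r addr0.
have lift0 S : lift S (const_delta S 0) = 0.
  by rewrite lift_delta /sS s0; exact: XP0.
apply: (@ext_iso_of_hom _ _ _ (tate_ext p F f) X phi (tate_ext_is_extension p F f) HX).
- split=> [S S' h x|S|S x y]; first exact: phin.
    rewrite /phi /= lift0 addr0; exact: i0.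
  (* Additivity is tested where both arguments lie over constants [a] and [b]. There the carry of
     the Tate group equals that of [sSD], by [qS]. *)
  apply: (separated2 (ext_separated HX (@base_formal_separated _ _ F T))
    (e := fib2 x) (f := fib2 y)).
  move=> a b S' h xa yb.
  rewrite -phin XPD -!phin.
  have [_ [_ MD] _] := tate_mid_laws p F f.
  rewrite MD [x]tate_mkE [y]tate_mkE !tate_mk_map xa yb.
  set g := nilp_map h _; set g' := nilp_map h _.
  rewrite (tate_mk_addT f (g : VG S') (g' : VG S')) !phi_mk.
  rewrite !lift_delta -mulNrn qS.
  have incD (v w : VG S') : ex_inc X (v + w) = (ex_inc X v : V S') + ex_inc X w by exact: iD.
  rewrite !incD (ext_incMn HX (GL := GL)).
  rewrite -[RHS]/(((ex_inc X g : V S') + sS S' a) + ((ex_inc X g' : V S') + sS S' b)).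
  rewrite [RHS]addrACA sSD; set t := sS S' (a + b).
  set w : V S' := (ex_inc X (cS S') : V S') *+ _.
  have AC (v v' : V S') : v + v' + w + t = v + v' + (t + w) by rewrite [t + w]addrC addrA.
  exact: AC.
- by move=> S g; rewrite tate_incE phi_mk lift0 addr0.
- move=> S x; rewrite /phi -[_ + lift S _]/(padd (ex_mid X) _ _) pD.
  rewrite (const_lift_proj HX sP (@const_liftP _ _ _ _ _ _ HX _ sP _ _)).
  have [_ _ _ ker _] := HX.
  rewrite ((ker S (ex_inc X (fib1 x).1)).2 (ex_intro _ _ erefl)).
  have [_ _ /(_ S)[_ _ z _]] := const_gs_laws T (QpZp p); exact: z.
Qed.
End TestRingExt.

(** * Naturality *)

Lemma tate_add_str (E : comUnitRingType) (F : fgl E) (R : comPzRingType)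
    (s t : {rmorphism fps E -> R})
    (sd : exists n, forall x, maxpow (fps E) n x -> s x = 0)
    (td : exists n, forall x, maxpow (fps E) n x -> t x = 0)
    (x y : nilp R * const_pts QZ R) :
  s =1 t -> @tate_add E F (DAlg sd) x y = @tate_add E F (DAlg td) x y.
Proof.
move=> /rmorphism_ext e; case: t / e td => td.
by have -> : td = sd by apply: Prop_irrelevance.
Qed.

Section Naturality.
Variables (k : fieldType) (p : nat) (E : complete_local_ring k) (F : fgl E).
Variables (T T' : test_ring E) (u : test_hom T T').

Lemma exseq_base_iso (A : zmodType) (G : group_functor E)
    (X Y : exseq A (base_change (tr_cmor T) G)) :
  ext_iso X Y -> ext_iso (exseq_base u X) (exseq_base u Y).
Proof.
move=> [f [f' [[[fn f0 fD] [fn' f0' fD']] fK fi fp]]].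
exists (fun S => f (res (th_cmor u) S)), (fun S => f' (res (th_cmor u) S)); split.
- by split; split=> [S S' h a|S|S a b]; rewrite /= ?fn ?fn' ?f0 ?f0' ?fD ?fD'.
- by move=> S; exact: fK.
- by move=> S g; exact: fi.
- by move=> S x; exact: (fp (res (th_cmor u) S) x).
Qed.

(** The comparison maps are the identity in coordinates; what changes is the path along which [S]
    becomes an algebra, handled by [addE]. *)
Lemma tate_ext_base (f : cont_hom T) :
  ext_iso (tate_ext p F (cont_hom_comp u f)) (exseq_base u (tate_ext p F f)).
Proof.
pose g := cont_hom_comp u f.
have st (S : dalg T') : da_str S \o (u \o f) =1 (da_str S \o u) \o f by [].
have addE (S : dalg T') (x y : tate_pts F (res g S)) :
    @tate_add E F (res g S) x y = @tate_add E F (res f (res (th_cmor u) S)) x y.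
  exact: (tate_add_str F _ _ _ _ (st S)).
exists (fun S (x : tate_mid p F g S) =>
  @tate_mk k E p F T f (res (th_cmor u) S) (fib1 x).1 (fib2 x)).
exists (fun S (x : tate_mid p F f (res (th_cmor u) S)) =>
  @tate_mk k E p F T' g S (fib1 x).1 (fib2 x)).
split.
- split; split=> [S S' h x|S|S x y].
  + by apply: fib_ext => //; congr (_, _); rewrite /= const_push_map.
  + by apply: fib_ext => //; congr (_, _); rewrite /= const_push_delta.
  + rewrite {1}[x]tate_mkE {1}[y]tate_mkE.
    by apply: fib_ext => //; rewrite [RHS](esym (addE S _ _)) [RHS]surjective_pairing;
      congr (_, _); exact: (@const_push_add (QpZp p) QZ _ val _ _).
  + by apply: fib_ext => //; congr (_, _); rewrite /= const_push_map.
  + by apply: fib_ext => //; congr (_, _); rewrite /= const_push_delta.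
  + rewrite {1}[x]tate_mkE {1}[y]tate_mkE.
    by apply: fib_ext => //; rewrite [RHS](addE S _ _) [RHS]surjective_pairing;
      congr (_, _); exact: (@const_push_add (QpZp p) QZ _ val _ _).
- by move=> S; split=> x; rewrite [RHS]tate_mkE.
- move=> S h; apply: fib_ext => //; congr (_, _); last by rewrite /= const_push_delta.
  exact: nilp_inj.
- by [].
Qed.
End Naturality.

Theorem lemma5p3p1 (k : fieldType) (p : nat) (p_char : p \in [pchar k])
    (E : complete_local_ring k) (F : fgl E) :
  (forall T : test_ring E,
     (forall f : cont_hom T, is_extension (tate_ext p F f)) /\
     bijective_onto (fun f : cont_hom T => ext_class (tate_ext p F f))
       (@ExtF k E (QpZp p) (formal_group F) T)) /\
  (forall (T T' : test_ring E) (u : test_hom T T') (f : cont_hom T),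
     ExtF_map u (ext_class (tate_ext p F f)) =
     ext_class (tate_ext p F (cont_hom_comp u f))).
Proof.
split=> [T|T T' u f].
  split=> [f|]; first exact: tate_ext_is_extension.
  split=> [f|f f' e|C [X HX ->]].
  - by exists (tate_ext p F f) => //; exact: tate_ext_is_extension.
  - apply: (tate_ext_inj p_char (F := F)).
    (* The Tate extension of [f'] lies in its own class, so equality of the classes yields an
       isomorphism to it from that of [f]. *)
    have : ext_class (tate_ext p F f') (tate_ext p F f').
      by split; [exact: tate_ext_is_extension | exact: ext_iso_refl].
    by rewrite -[ext_class (tate_ext p F f')]e => -[].
  - have [f fX] := tate_ext_surj p_char HX.
    by exists f; exact: ext_class_eq.
have base := tate_ext_base p F u f.
apply/funext => Y; apply/propext; split=> [[HY [X [HX iX] iY]]|[HY iY]]; split=> //.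
  exact: ext_iso_trans base (ext_iso_trans (exseq_base_iso u iX) iY).
exists (tate_ext p F f); first by split; [exact: tate_ext_is_extension | exact: ext_iso_refl].
exact: ext_iso_trans (ext_iso_sym base) iY.
Qed.
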